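(* Consider the minimization over $\mathbb{R}^d$ of $f=\frac1M\sum_{m=1}^M f_m$, where every $f_m$ is $\delta$-related to $f$ and $f$ is $\mu$-strongly convex, and let $x_*$ be its minimizer. Let the problem be solved by the algorithm OLGA (described in the context) with an unbiased compressor $Q$ with constant $\omega>1$ and compression power $\gamma_\omega\ge\omega$, and with parameters $$p=\frac1{\gamma_\omega},\quad \theta=\min\left\{\frac{\sqrt p\,\sqrt M}{8\delta\sqrt\omega},\frac1{2\delta}\right\},\quad \tau=\min\left\{\frac{\sqrt\mu\,\theta^{1/2}p^{-1/2}}{4},\frac14\right\},\quad \alpha=\frac{\theta p^{-1}}{8\tau}.$$ Then, to reach $\mathbb{E}[f(y_K)-f(x_* )]\le\varepsilon$, OLGA has (in expectation) communication complexities $$\text{CC-1}:\ \tilde{\mathcal O}\left(\gamma_\omega+\sqrt{\tfrac{\delta}{\mu}}\left[\gamma_\omega M^{-1/4}+\gamma_\omega^{1/2}\right]\right),$$ $$\text{CC-2}:\ \tilde{\mathcal O}\left(M\gamma_\omega+\sqrt{\tfrac{\delta}{\mu}}\left[\gamma_\omega M^{3/4}+M\gamma_\omega^{1/2}\right]\right),$$ $$\text{CC-3}:\ \tilde{\mathcal O}\left(1+\sqrt{\tfrac{\delta}{\mu}}\left[M^{-1/4}+\gamma_\omega^{-1/2}\right]\right).$$ Here $\tilde{\mathcal O}(A)$ means: there is a universal constant $C$ such that for every $\varepsilon>0$ there is a number $K$ of iterations with $\mathbb{E}[f(y_K)-f(x_* )]\le\varepsilon$ for which the expected value of the respective complexity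 over the first $K$ iterations is at most $C\,A\left(1+\log^+\frac{f(y_0)-f(x_* )}{\varepsilon}\right)$, with $\log^+ t=\max\{0,\log t\}$ and $\log^+0=0$.
   Context: Setting: $f_1,\dots,f_M:\mathbb{R}^d\to\mathbb{R}$ are twice differentiable (in the application $f_m(x)=\frac1{n_m}\sum_{j=1}^{n_m}\ell(x,z_j^m)$ is the local loss on node $m$), $f=\frac1M\sum_{m=1}^M f_m$, node $1$ is the server. The norm is Euclidean (spectral norm for matrices). $\delta$-relatedness: $\delta>0$ and $\|\nabla^2 f_m(x)-\nabla^2 f(x)\|\le\delta$ for all $x\in\mathbb{R}^d$ and all $m$. (The $f_m$ may be non-convex.) $\mu$-strong convexity: $\mu>0$ and $f(x)\ge f(y)+\langle\nabla f(y),x-y\rangle+\frac\mu2\|x-y\|^2$ for all $x,y\in\mathbb{R}^d$. Unbiased compressor with constant $\omega>1$: a random map $Q:\mathbb{R}^d\to\mathbb{R}^d$ with $\mathbb{E}_Q[Q(x)]=x$ and $\mathbb{E}_Q[\|Q(x)-x\|^2]\le\omega\|x\|^2$ for all $x\in\mathbb{R}^d$. Every application of $Q$ (on different nodes and at different iterations) uses independent randomness, independent also of the variables $N$ below. Compression power $\gamma_\omega$: if $b$ is the number of bits representing one float and $\|\cdot\|_{bits}$ the number of bits needed to represent a vector, $\gamma_\omega^{-1}=\frac1{bd}\mathbb{E}\|Q(z)\|_{bits}$ (i.e. on average a compressed vector costs a fraction $1/\gamma_\omega$ of an uncompressed one). Epoch procedure $\mathrm{Epoch}(u_0,\theta,p)$: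 draw $N\sim\mathrm{Geom}(p)$, i.e. $\Pr[N=n]=p(1-p)^{n-1}$ for $n=1,2,\dots$ The server collects $\nabla f(u_0)$ (one round in which each node sends an uncompressed vector). For $j=0,1,\dots,N-1$: for each $m$ put $\hat g_j^m=\nabla f_m(u_j)-\nabla f_1(u_j)-\nabla f_m(u_0)+\nabla f_1(u_0)$ and send $g_j^m=Q(\hat g_j^m)$ to the server (one round in which each node sends a compressed vector); put $g_j=\frac1M\sum_{m=1}^M g_j^m$ and $s_j=g_j-\nabla f_1(u_0)+\nabla f(u_0)$; set $u_{j+1}=\arg\min_{u\in\mathbb{R}^d}\left\{\langle s_j,u-u_j\rangle+\frac1{2\theta}\|u-u_j\|^2+f_1(u)\right\}$. Output $u_N$. OLGA: input $z_0=y_0\in\mathbb{R}^d$, $p\in(0,1)$, $\theta>0$, $\tau\in(0,1)$, $\alpha>0$. For $k=0,1,2,\dots$: $x_{k+1}=\tau z_k+(1-\tau)y_k$; $y_{k+1}=\mathrm{Epoch}(x_{k+1},\theta,p)$ (with fresh randomness); the server collects $\nabla f(y_{k+1})$ (one round in which each node sends an uncompressed vector); $t_k=\nabla(f_1-f)(x_{k+1})-\nabla(f_1-f)(y_{k+1})$; $G_{k+1}=p\left(t_k+\frac{x_{k+1}-y_{k+1}}{\theta}\right)$; $z_{k+1}=\arg\min_{z\in\mathbb{R}^d}\left\{\frac1{2\alpha}\|z-z_k\|^2+\langle G_{k+1},z\rangle+\frac\mu2\|z-y_{k+1}\|^2\right\}$. Complexity measures: CC-1 is the number of communication rounds; CC-2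 is the number of client-server communications (a round involving all $M$ nodes counts $M$); CC-3 is the communication time, where nodes transmit in parallel and a round counts as the amount of information sent by each node, so (up to a fixed time unit) a round with uncompressed vectors counts $1$ and a round with compressed vectors counts $1/\gamma_\omega$ (average). Server-to-client communication is not counted. Thus one iteration of OLGA has $2$ uncompressed rounds and $N$ compressed rounds. $\mathbb{E}$ is expectation over all randomness. *)

(* Defs.v *)
From HB Require Import structures.
From mathcomp Require Import all_boot all_order all_algebra.
From mathcomp Require Import all_classical all_reals all_analysis.

Set Implicit Arguments.
Unset Strict Implicit.
Unset Printing Implicit Defensive.
Import Order.TTheory GRing.Theory Num.Theory numFieldNormedType.Exports.
Local Open Scope classical_set_scope.
Local Open Scope ring_scope.

Section Euclidean.
Context {R : realType} {d : nat}.
Implicit Types (u v : 'rV[R]_d) (A : 'M[R]_d) (F : 'rV[R]_d -> R).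

Definition dotp u v : R := \sum_(i < d) u 0 i * v 0 i.

(* The library norm on matrices is the sup norm, hence these two. *)
Definition enorm v : R := Num.sqrt (dotp v v).

Definition spectral_norm A : R :=
  sup [set enorm (v *m A) | v in [set v | enorm v <= 1]].

Definition grad F (x : 'rV[R]_d) : 'rV[R]_d :=
  \row_(i < d) 'D_(delta_mx 0 i) F x.

Definition hess F (x : 'rV[R]_d) : 'M[R]_d := jacobian (grad F) x.

Definition twice_differentiable F :=
  forall x, differentiable F x /\ differentiable (grad F) x.

(* Some global minimizer of F; the value is 0 when there is none. *)
Definition argmin F : 'rV[R]_d := xget 0 [set x | forall y, F x <= F y].

Definition strongly_convex (mu : R) F := forall x y : 'rV[R]_d,
  F x >= F y + dotp (grad F y) (x - y) + mu / 2 * enorm (x - y) ^+ 2.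

End Euclidean.

Section Problem.
Context {R : realType} {d M : nat}.
Variable f : 'I_M -> 'rV[R]_d -> R.

Definition favg (x : 'rV[R]_d) : R := M%:R^-1 * \sum_(m < M) f m x.

Definition delta_related (delta : R) := forall (m : 'I_M) (x : 'rV[R]_d),
  spectral_norm (hess (f m) x - hess favg x) <= delta.

End Problem.

Section Compressor.
Context {R : realType} {d : nat} {dX : measure_display} {X : measurableType dX}.
(* A random map is given by a probability nu on a space X of seeds and the
   map Q, where Q s is the realization for the seed s.  *)
Variables (nu : probability X R) (Q : X -> 'rV[R]_d -> 'rV[R]_d).

(* R^d carries its Borel sigma-algebra through the measurable type of tuples. *)
Definition row_of_tuple (t : d.-tuple R) : 'rV[R]_d := \row_(j < d) tnth t j.

Definition measurable_random_map := forall i : 'I_d,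
  measurable_fun [set: X * d.-tuple R]
    (fun q => Q q.1 (row_of_tuple q.2) 0 i).

Definition unbiased_compressor (omega : R) :=
  [/\ measurable_random_map,
      forall x i, ('E_nu[fun s => (Q s x 0 i)%R] = (x 0 i)%:E)%E
    & forall x, ('E_nu[fun s => (enorm (Q s x - x) ^+ 2)%R]
                 <= (omega * enorm x ^+ 2)%R%:E)%E].

(* b is the number of bits of a float, bits v that of the encoding of v. *)
Definition compression_power (b : nat) (bits : 'rV[R]_d -> nat) (gamma : R) :=
  measurable_fun [set: d.-tuple R] (bits \o row_of_tuple) /\
  forall z, ((gamma^-1)%:E =
    (((b * d)%:R : R)^-1)%:E * 'E_nu[fun s => ((bits (Q s z))%:R)%R])%E.

End Compressor.

Section Randomness.
Context {R : realType} {dO : measure_display} {Omega : measurableType dO}.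
Variable P : probability Omega R.

(* Mutual independence of a family of set systems. *)
Definition independent_systems (I : eqType) (S : I -> set (set Omega)) :=
  forall (J : seq I) (A : I -> set Omega), uniq J ->
    (forall i, i \in J -> S i (A i)) ->
    P (\big[setI/setT]_(i <- J) A i) = (\prod_(i <- J) P (A i))%E.

Definition geometric_law (p : R) (N : Omega -> nat) := forall n : nat,
  (0 < n)%N -> P (N @^-1` [set n]) = (p * (1 - p) ^+ n.-1)%:E.

Context {M : nat} {dX : measure_display} {X : measurableType dX}.

Definition source_events (N : nat -> Omega -> nat)
    (xi : nat -> nat -> 'I_M -> Omega -> X)
    (i : nat + nat * nat * 'I_M) : set (set Omega) :=
  match i with
  | inl k => preimage_set_system setT (N k) measurable
  | inr (k, j, m) => preimage_set_system setT (xi k j m) measurable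
  end.

(* N k is the length of the epoch run in iteration k, and xi k j m is the seed
   used by node m for the compression at step j of that epoch.  *)
Definition olga_randomness (nu : probability X R) (p : R)
    (N : nat -> Omega -> nat) (xi : nat -> nat -> 'I_M -> Omega -> X) :=
  [/\ forall k, measurable_fun setT (N k) /\ geometric_law p (N k),
      forall k j m, measurable_fun setT (xi k j m) /\
        forall B, measurable B -> P (xi k j m @^-1` B) = nu B
    & independent_systems (source_events N xi)].

End Randomness.

Section Algorithm.
Context {R : realType} {d M : nat} {X : Type}.
Variables (f : 'I_M -> 'rV[R]_d -> R) (server : 'I_M).
Variable Q : X -> 'rV[R]_d -> 'rV[R]_d.

Local Notation f1 := (f server).
Local Notation fbar := (favg f).

Definition epoch_step (theta : R) (s : 'I_M -> X) (u0 u : 'rV[R]_d) :=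
  let ghat m := grad (f m) u - grad f1 u - grad (f m) u0 + grad f1 u0 in
  let g := M%:R^-1 *: \sum_(m < M) Q (s m) (ghat m) in
  let sj := g - grad f1 u0 + grad fbar u0 in
  argmin (fun v => dotp sj (v - u)
                   + (2 * theta)^-1 * enorm (v - u) ^+ 2 + f1 v).

Fixpoint epoch (theta : R) (s : nat -> 'I_M -> X) (u0 : 'rV[R]_d) (n : nat) :=
  if n is j.+1 then epoch_step theta (s j) u0 (epoch theta s u0 j) else u0.

Definition olga_x (tau : R) (yz : 'rV[R]_d * 'rV[R]_d) : 'rV[R]_d :=
  tau *: yz.2 + (1 - tau) *: yz.1.

Definition olga_step (mu p theta tau alpha : R) (n : nat)
    (s : nat -> 'I_M -> X) (yz : 'rV[R]_d * 'rV[R]_d) :=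
  let x := olga_x tau yz in
  let y := epoch theta s x n in
  let t := (grad f1 x - grad fbar x) - (grad f1 y - grad fbar y) in
  let G := p *: (t + theta^-1 *: (x - y)) in
  let z := argmin (fun v => (2 * alpha)^-1 * enorm (v - yz.2) ^+ 2
                            + dotp G v + mu / 2 * enorm (v - y) ^+ 2) in
  (y, z).

(* The pair (y_k, z_k), for given epoch lengths N and seeds s. *)
Fixpoint olga (mu p theta tau alpha : R) (y0 : 'rV[R]_d)
    (N : nat -> nat) (s : nat -> nat -> 'I_M -> X) (k : nat) :=
  if k is k'.+1 then
    olga_step mu p theta tau alpha (N k') (s k')
      (olga mu p theta tau alpha y0 N s k')
  else (y0, y0).

Definition olga_y mu p theta tau alpha y0 N s k : 'rV[R]_d :=
  (olga mu p theta tau alpha y0 N s k).1.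

End Algorithm.

Section Complexity.
Context {R : realType}.
Variables (K : nat) (N : nat -> nat).

(* Iteration k has 2 rounds with uncompressed vectors, of cost c each, and
   N k rounds with compressed vectors, of cost c' each.  *)
Definition comm_cost (c c' : R) : R := \sum_(k < K) (2 * c + (N k)%:R * c').

Definition CC1 : R := comm_cost 1 1.
Definition CC2 (M : nat) : R := comm_cost M%:R M%:R.
Definition CC3 (gamma : R) : R := comm_cost 1 gamma^-1.

End Complexity.

Definition logp {R : realType} (t : R) : R := Num.max 0 (ln t).

(* Main.v *)
Require Import Defs.
From HB Require Import structures.
From mathcomp Require Import all_boot all_order all_algebra.
From mathcomp Require Import all_classical all_reals all_analysis.
From mathcomp Require Import measurable_realfun ring lra.
Import Order.TTheory GRing.Theory Num.Theory numFieldNormedType.Exports.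
Local Open Scope classical_set_scope.
Local Open Scope ring_scope.
Set Implicit Arguments.
Unset Strict Implicit.
Unset Printing Implicit Defensive.

(** The corollary follows from a contraction: with the potential
      Phi (y, z) = f y - f xs + tau (1 / (2 alpha) + mu / 2) |z - xs|^2,
    one iteration satisfies E Phi' <= (1 - tau) E Phi (iteration_contracts). As Phi is
    at most twice the gap at the start, about L / tau iterations suffice
    (iteration_count). An iteration costs two uncompressed rounds and on average
    gamma compressed ones (expected_cost), and 1 / tau is at most 12 times the third
    of the rates A1 = gamma A3, A2 = M gamma A3 and A3 (inv_tau_le).

    One step of an epoch. The Hessian bound makes the gradient of f1 - f Lipschitz with
    constant delta (jacobian_diff_lipschitz). Since delta <= 1 / (2 theta), the function
    f1 - f + |.|^2 / (2 theta) is convex and its Bregman distance D lies between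
    |.|^2 / (4 theta) and |.|^2 / theta. In terms of D the exact minimization over f1
    is a mirror descent step for f, and strong convexity of f gives
      f u' + D v u' + D u' u + mu/2 |v - u'|^2 <= f v + D v u + <e, v - u'>
    for every v (prox_step), where e is the error of the estimated gradient. The step is
    compared with v = xs and v = y, with weights tau and 1 - tau (epoch_step_bound).

    Compression. The error e is an average of M independent centered errors, whose
    variances are at most omega times the square norms of the compressed vectors, and
    these are at most 4 delta^2 times the square distance r from u to the start x of
    the epoch. The choice of theta makes omega / M * 4 delta^2 at most p / (16 theta^2).
    In place of conditional expectations, the past of a step generates a sigma-algebra
    independent of a fresh seed, so by Tonelli's theorem the seed is integrated out
    first (fresh_source), one node after the other (expected_sqr_sum_sources).

    The random length. For a geometric length N the mean of a (N - 1) is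
    p (a 0) + (1 - p) E (a N). So the decrease of the mixed distance a along one step,
    averaged over N, becomes p (a 0 - a N), an inequality between the two ends of the
    epoch; and the errors, proportional to r (N - 1) with r 0 = 0, are bounded by the
    mean of r N (weighted_descent).

    The z step. By the three-point identity tau times the inner product of G with xs - z is
    p times the change of the mixed distance over the epoch minus p D x y, so adding it
    cancels p (a 0 - a N). The surplus p D x y, at least p |x - y|^2 / (4 theta), pays
    for the square of G and for the compression errors (potential_bound).

    All expectations are integrals of nonnegative functions. Whenever a term is
    cancelled its finiteness comes from the square integrability of the iterates,
    which is propagated along the method by the same inequalities. *)

(** * Euclidean space *)

Section EuclideanTheory.
Context {R : realType} {d : nat}.
Implicit Types (u v w x y : 'rV[R]_d) (A : 'M[R]_d) (c : R).

Lemma dotpC u v : dotp u v = dotp v u.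
Proof. by apply: eq_bigr => i _; rewrite mulrC. Qed.

Lemma dotpDl u v w : dotp (u + v) w = dotp u w + dotp v w.
Proof. by rewrite -big_split; apply: eq_bigr => i _; rewrite !mxE mulrDl. Qed.

Lemma dotpDr u v w : dotp u (v + w) = dotp u v + dotp u w.
Proof. by rewrite dotpC dotpDl !(dotpC u). Qed.

Lemma dotpZl c u v : dotp (c *: u) v = c * dotp u v.
Proof. by rewrite mulr_sumr; apply: eq_bigr => i _; rewrite !mxE mulrA. Qed.

Lemma dotpZr c u v : dotp u (c *: v) = c * dotp u v.
Proof. by rewrite dotpC dotpZl dotpC. Qed.

Lemma dotpNl u v : dotp (- u) v = - dotp u v.
Proof. by rewrite -scaleN1r dotpZl mulN1r. Qed.

Lemma dotpNr u v : dotp u (- v) = - dotp u v.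
Proof. by rewrite dotpC dotpNl dotpC. Qed.

Definition dotpE := (dotpDl, dotpDr, dotpNl, dotpNr, dotpZl, dotpZr).

Lemma dotp0l u : dotp 0 u = 0.
Proof. by rewrite -(scale0r 0) dotpZl mul0r. Qed.

Lemma dotp0r u : dotp u 0 = 0.
Proof. by rewrite dotpC dotp0l. Qed.

Lemma enorm0 : enorm (0 : 'rV[R]_d) = 0.
Proof. by rewrite /enorm dotp0l sqrtr0. Qed.

Lemma dotp_ge0 u : 0 <= dotp u u.
Proof. by apply: sumr_ge0 => i _; rewrite -expr2 sqr_ge0. Qed.

Lemma dotp_eq0 u : dotp u u = 0 -> u = 0.
Proof.
move=> /eqP; rewrite psumr_eq0 => [/allP u0|i _]; last by rewrite -expr2 sqr_ge0.
apply/rowP => i; rewrite mxE; apply/eqP.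
by have := u0 i (mem_index_enum _); rewrite -expr2 sqrf_eq0.
Qed.

Lemma enorm_ge0 u : 0 <= enorm u.
Proof. exact: sqrtr_ge0. Qed.

Lemma enorm_sqr u : enorm u ^+ 2 = dotp u u.
Proof. by rewrite sqr_sqrtr // dotp_ge0. Qed.

Lemma dotp_young c u v : 0 < c ->
  dotp u v <= c / 2 * dotp u u + (2 * c)^-1 * dotp v v.
Proof.
move=> c0; have := dotp_ge0 (c *: u - v).
rewrite !dotpE (dotpC v u) => h.
have /(mulr_ge0 (ltW (_ : 0 < (2 * c)^-1))) : 0 <=
  c * (c * dotp u u) - c * dotp u v - (c * dotp u v - dotp v v) by lra.
rewrite invr_gt0 mulr_gt0 // => /(_ isT).
suff -> : (2 * c)^-1 * (c * (c * dotp u u) - c * dotp u v -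
   (c * dotp u v - dotp v v)) = c / 2 * dotp u u + (2 * c)^-1 * dotp v v
   - dotp u v by lra.
by field; rewrite gt_eqF.
Qed.

Lemma dotp_le u v : dotp u v <= enorm u * enorm v.
Proof.
have [u0|u0] := eqVneq (dotp u u) 0.
  by rewrite (dotp_eq0 u0) dotp0l mulr_ge0 // enorm_ge0.
have [v0|v0] := eqVneq (dotp v v) 0.
  by rewrite (dotp_eq0 v0) dotpC dotp0l mulr_ge0 // enorm_ge0.
have nu : 0 < enorm u by rewrite sqrtr_gt0 lt_def u0 dotp_ge0.
have nv : 0 < enorm v by rewrite sqrtr_gt0 lt_def v0 dotp_ge0.
apply: le_trans (dotp_young _ _ (divr_gt0 nv nu)) _.
rewrite -!enorm_sqr le_eqVlt; apply/orP; left; apply/eqP; field.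
by rewrite !gt_eqF.
Qed.

Lemma enormN u : enorm (- u) = enorm u.
Proof. by rewrite /enorm dotpNl dotpNr opprK. Qed.

Lemma enorm0_eq0 u : enorm u = 0 -> u = 0.
Proof. by move=> u0; apply: dotp_eq0; rewrite -enorm_sqr u0 expr0n. Qed.

Lemma enormZ c u : enorm (c *: u) = `|c| * enorm u.
Proof.
by rewrite /enorm dotpZl dotpZr mulrA -expr2 sqrtrM ?sqr_ge0 // sqrtr_sqr.
Qed.

Lemma coord_le_enorm u i : `|u 0 i| <= enorm u.
Proof.
rewrite -sqrtr_sqr ler_wsqrtr // /dotp (bigD1 i) //= -expr2 lerDl.
by apply: sumr_ge0 => j _; rewrite -expr2 sqr_ge0.
Qed.

(** The topology of the matrix spaces is that of the sup norm; this inequality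
    makes Euclidean estimates usable in limits. *)
Lemma mx_norm_le_enorm u : `|u| <= enorm u.
Proof.
rewrite [`|u|]mx_normrE; apply: bigmax_le => [|[i j] _ /=]; first exact: enorm_ge0.
by rewrite (ord1 i); exact: coord_le_enorm.
Qed.

(** The supremum that defines the spectral norm is over a bounded set, by the
    Hilbert-Schmidt norm; a vector is then compared with its normalization. *)
Lemma spectral_norm_le A u : enorm (u *m A) <= spectral_norm A * enorm u.
Proof.
have ub : has_ubound [set enorm (v *m A) | v in [set v | enorm v <= 1]].
  exists (Num.sqrt (\sum_j (\sum_i `|A i j|) ^+ 2)) => _ [v /= v1 <-].
  rewrite ler_wsqrtr //; apply: ler_sum => j _.
  rewrite -expr2 -[leLHS]ger0_norm ?sqr_ge0 // normrX.
  apply: lerXn2r; rewrite ?nnegrE ?sumr_ge0 //.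
  rewrite mxE; apply: le_trans (ler_norm_sum _ _ _) _.
  apply: ler_sum => i _; rewrite normrM ler_piMl //.
  exact: le_trans (coord_le_enorm _ _) v1.
have [u0|u0] := eqVneq (enorm u) 0.
  by rewrite u0 mulr0 (enorm0_eq0 u0) mul0mx /enorm dotp0l sqrtr0.
have nu : 0 < enorm u by rewrite lt_def u0 enorm_ge0.
rewrite -ler_pdivrMr // mulrC -[(enorm u)^-1]ger0_norm ?invr_ge0 ?enorm_ge0 //.
rewrite -enormZ scalemxAl; apply: ub_le_sup => //=.
exists ((enorm u)^-1 *: u) => //=.
by rewrite enormZ ger0_norm ?invr_ge0 ?enorm_ge0 // mulVf.
Qed.

End EuclideanTheory.

(** * Gradients *)

Section Calculus.
Context {R : realType} {d : nat}.
Implicit Types (F G : 'rV[R]_d -> R) (u v w x y : 'rV[R]_d).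

Lemma diff_gradE F x v : differentiable F x -> 'd F x v = dotp (grad F x) v.
Proof.
move=> dF; rewrite {1}[v]row_sum_delta linear_sum /=; apply: eq_bigr => i _.
by rewrite linearZ /= mxE deriveE // mulrC.
Qed.

Lemma grad_unique F x u : differentiable F x ->
  (forall v, 'd F x v = dotp u v) -> grad F x = u.
Proof.
move=> dF h; apply/eqP; rewrite -subr_eq0; apply/eqP/dotp_eq0.
set z := grad F x - u.
by rewrite /z dotpDl dotpNl -diff_gradE // h subrr.
Qed.

Lemma is_derive_line F x v (t : R) : differentiable F (x + t *: v) ->
  is_derive t 1 (fun s => F (x + s *: v)) ('d F (x + t *: v) v).
Proof.
move=> dF.
have dl : is_diff t (fun s : R => x + s *: v) (fun s : R => s *: v).
  have -> : (fun s : R => s *: v) = (0 : R -> _) + (fun s : R => s *: v).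
    by rewrite funeqE => s /=; rewrite fctE add0r.
  apply: is_diffD.
have dl' : differentiable (fun s : R => x + s *: v) t by exact: ex_diff.
have dFl := differentiable_comp dl' dF.
apply: DeriveDef; first exact: diff_derivable.
by rewrite deriveE // diff_comp //= diff_val scale1r.
Qed.

Lemma mean_value F x v : (forall y, differentiable F y) ->
  exists2 c : R, 0 < c < 1 & F (x + v) - F x = 'd F (x + c *: v) v.
Proof.
move=> dF.
have dl t := is_derive_line (dF (x + t *: v)).
have [|c c01] := @MVT R _ _ 0 1 ltr01 (fun t _ => dl t).
  apply: derivable_within_continuous => t _; exact: ex_derive.
by rewrite scale1r scale0r addr0 subr0 mulr1 => h; exists c.
Qed.

Lemma diff_at_min F x v : (forall y, differentiable F y) ->
  (forall y, F x <= F y) -> 'd F x v = 0.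
Proof.
move=> dF minF; have dl t := is_derive_line (dF (x + t *: v)).
have := @derive1_at_min R (fun s => F (x + s *: v)) (- 1) 1 0.
have -> : (- 1 <= 1 :> R) by lra.
case/(_ isT) => [t _| | t _|_ h].
- by have := dl t; case.
- by rewrite in_itv /=; apply/andP; split; lra.
- by rewrite scale0r addr0.
- by have := dl 0; rewrite scale0r addr0 => -[_ <-].
Qed.

End Calculus.

Section Gradients.
Context {R : realType} {d : nat}.
Implicit Types (F G : 'rV[R]_d -> R) (a b u v w x y : 'rV[R]_d).

(** The gradient as a relation: composite expressions can be differentiated by
    applying the rules below, with no rewriting under grad. *)
Definition has_grad F x u :=
  differentiable F x /\ forall v, 'd F x v = dotp u v.

Lemma has_gradE F x u : has_grad F x u -> grad F x = u.
Proof. by case=> dF; exact: grad_unique. Qed.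

Lemma has_grad_grad F x : differentiable F x -> has_grad F x (grad F x).
Proof. by move=> dF; split => // v; exact: diff_gradE. Qed.

Lemma has_gradD F G x u v : has_grad F x u -> has_grad G x v ->
  has_grad (fun z => F z + G z) x (u + v).
Proof.
move=> [dF Fu] [dG Gv]; split; first exact: differentiableD.
by move=> w; rewrite (diffD dF dG) /= Fu Gv dotpDl.
Qed.

Lemma has_gradZ c F x u : has_grad F x u -> has_grad (fun z => c * F z) x (c *: u).
Proof.
move=> [dF Fu]; split; first exact: (differentiableZ c dF).
by move=> w; rewrite (diffZ c dF) /= Fu dotpZl.
Qed.

Lemma has_gradB F G x u v : has_grad F x u -> has_grad G x v ->
  has_grad (fun z => F z - G z) x (u - v).
Proof.
move=> hF hG; have := has_gradD hF (has_gradZ (-1) hG); rewrite scaleN1r.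
by under eq_fun do rewrite mulN1r.
Qed.

Lemma has_grad_cst c x : has_grad (fun=> c) x 0.
Proof.
split; first exact: differentiable_cst.
by move=> v; rewrite diff_cst dotp0l.
Qed.

Lemma has_grad_sum (I : Type) (s : seq I) (F : I -> 'rV[R]_d -> R) x
    (u : I -> 'rV[R]_d) : (forall i, has_grad (F i) x (u i)) ->
  has_grad (fun z => \sum_(i <- s) F i z) x (\sum_(i <- s) u i).
Proof.
move=> h; elim: s => [|i s ih].
  rewrite big_nil; under eq_fun do rewrite big_nil; exact: has_grad_cst.
rewrite big_cons; under eq_fun do rewrite big_cons.
exact: (has_gradD (h i) ih).
Qed.

(** The inner product as a function of its first argument, a name to which a
    linear structure can be attached. *)
Definition dotpr w z : R := dotp z w.

Fact dotpr_is_linear w : linear (dotpr w).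
Proof. by move=> c u v; rewrite /dotpr dotpDl dotpZl. Qed.

HB.instance Definition _ w :=
  GRing.isLinear.Build R 'rV[R]_d R _ (dotpr w) (dotpr_is_linear w).

Lemma dotpr_continuous w : continuous (dotpr w).
Proof.
rewrite /dotpr /dotp => z.
have cw i : {for z, continuous (fun z : 'rV[R]_d => z 0 i * w 0 i)}.
  by apply: continuousM; [exact: coord_continuous|exact: cst_continuous].
elim: (index_enum _) => [|i s ih].
  by rewrite (_ : (fun _ => _) = cst 0); [exact: cst_continuous|rewrite funeqE => y; rewrite big_nil].
rewrite (_ : (fun _ => _) = (fun y => y 0 i * w 0 i + \sum_(i <- s) y 0 i * w 0 i)).
  exact: (continuousD (cw i) ih).
by rewrite funeqE => y; rewrite big_cons.
Qed.

Lemma diff_dotp (h : 'rV[R]_d -> 'rV[R]_d) w x : differentiable h x ->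
  differentiable (fun y => dotp (h y) w) x /\
  forall v, 'd (fun y => dotp (h y) w) x v = dotp ('d h x v) w.
Proof.
move=> dh.
have dw y : differentiable (dotpr w) y.
  by apply: linear_differentiable; exact: dotpr_continuous.
split; first exact: (differentiable_comp dh (dw _)).
move=> v; rewrite (diff_comp dh (dw _)) /=.
by rewrite diff_lin //; exact: dotpr_continuous.
Qed.

Lemma has_grad_dotp b a x : has_grad (fun z => dotp b (z - a)) x b.
Proof.
have -> : (fun z => dotp b (z - a)) = (fun z => dotpr b z - dotp a b).
  by rewrite funeqE => z; rewrite dotpC dotpDl dotpNl.
rewrite -[X in has_grad _ _ X]subr0; apply: has_gradB; last exact: has_grad_cst.
split; first by apply: linear_differentiable; exact: dotpr_continuous.
by move=> v; rewrite diff_lin ?/dotpr 1?dotpC //; exact: dotpr_continuous.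
Qed.

Lemma has_gradM F G x u v : has_grad F x u -> has_grad G x v ->
  has_grad (fun z => F z * G z) x (F x *: v + G x *: u).
Proof.
move=> [dF Fu] [dG Gv]; split; first exact: differentiableM.
move=> w; rewrite (diffM dF dG) dotpDl !dotpZl -Fu -Gv.
by [].
Qed.

(** The square distance is a sum of squares of affine forms, so the product rule
    applies to each coordinate. *)
Lemma has_grad_sqdist c a x :
  has_grad (fun z => c * enorm (z - a) ^+ 2) x ((2 * c) *: (x - a)).
Proof.
rewrite mulrC -scalerA; apply: has_gradZ.
have -> : (fun z => enorm (z - a) ^+ 2) = (fun z => \sum_(i < d)
    dotp (delta_mx 0 i) (z - a) * dotp (delta_mx 0 i) (z - a)).
  rewrite funeqE => z; rewrite enorm_sqr; apply: eq_bigr => i _.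
  suff -> : dotp (delta_mx 0 i) (z - a) = (z - a) 0 i by [].
  rewrite /dotp (bigD1 i) //= big1 => [|j ji]; rewrite !mxE ?eqxx ?mul1r ?addr0 //.
  by rewrite (negbTE ji) mul0r.
rewrite [X in has_grad _ _ X](_ : _ = \sum_(i < d)
  (dotp (delta_mx 0 i) (x - a) *: delta_mx 0 i +
   dotp (delta_mx 0 i) (x - a) *: delta_mx 0 i)).
  by apply: has_grad_sum => i; apply: has_gradM; exact: has_grad_dotp.
rewrite big_split /= -mulr2n scaler_nat; congr (_ *+ _).
rewrite {1}[x - a]row_sum_delta; apply: eq_bigr => i _; congr (_ *: _).
rewrite /dotp (bigD1 i) //= big1 => [|j ji]; rewrite !mxE ?eqxx ?mul1r ?addr0 //.
by rewrite (negbTE ji) mul0r.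
Qed.

End Gradients.


(** * Lipschitz gradients from Hessian bounds *)

Section Relatedness.
Context {R : realType} {d : nat}.
Implicit Types (F G : 'rV[R]_d -> R) (a b u v w x y : 'rV[R]_d).

Lemma enorm_le_dotp u (B : R) : 0 <= B ->
  (forall w, dotp u w <= B * enorm w) -> enorm u <= B.
Proof.
move=> B0 /(_ u); rewrite -enorm_sqr expr2.
have [->//|u0] := eqVneq (enorm u) 0.
by rewrite ler_pM2r // lt_def u0 enorm_ge0.
Qed.

Lemma jacobianB (g h : 'rV[R]_d -> 'rV[R]_d) x :
  differentiable g x -> differentiable h x ->
  jacobian (g - h) x = jacobian g x - jacobian h x.
Proof.
move=> dg dh; apply/matrixP => i j.
have /(congr1 (fun L : 'rV[R]_d -> 'rV[R]_d => L (delta_mx 0 i) 0 j)) := diffB dg dh.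
have jE k : jacobian k x i j = 'd k x (delta_mx 0 i) 0 j by rewrite /jacobian /lin1_mx !mxE.
have mxBE m (A B : 'M[R]_(m, d)) k : (A - B) k j = A k j - B k j by rewrite !mxE.
move=> E.
rewrite [RHS]mxBE.
apply: (etrans (jE (g - h))).
apply: (etrans E).
apply: (etrans (mxBE _ _ _ _)).
apply/esym.
have ab (a b a' b' : R) : a = a' -> b = b' -> a - b = a' - b' by move=> -> ->.
apply: ab; [exact: jE|exact: jE].
Qed.

(** The mean value theorem holds only for real functions: it is applied to the
    inner product of g - h with an arbitrary direction w. *)
Lemma jacobian_diff_lipschitz (g h : 'rV[R]_d -> 'rV[R]_d) (delta : R) :
  0 <= delta -> (forall x, differentiable g x) -> (forall x, differentiable h x) ->
  (forall x, spectral_norm (jacobian g x - jacobian h x) <= delta) ->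
  forall x y, enorm ((g x - h x) - (g y - h y)) <= delta * enorm (x - y).
Proof.
move=> d0 dg dh gh x y.
apply: enorm_le_dotp => [|w]; first by rewrite mulr_ge0 // enorm_ge0.
have dk z : differentiable (g - h) z by exact: differentiableB.
have dkw z := diff_dotp w (dk z).
have [c _] := mean_value y (x - y) (fun z => (dkw z).1).
rewrite /= (dkw _).2 (_ : y + (x - y) = x); last by rewrite addrC subrK.
set p := y + _.
have -> : 'd (g - h) p (x - y) = (x - y) *m (jacobian g p - jacobian h p).
  by rewrite -jacobianB // -deriveEjacobian // deriveE.
move=> E; rewrite dotpDl dotpNl {}E; apply: le_trans (dotp_le _ _) _.
apply: ler_wpM2r; first exact: enorm_ge0.
apply: le_trans (spectral_norm_le _ _) _.
by apply: ler_wpM2r; first exact: enorm_ge0.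
Qed.

(** Subtracting from F its quadratic upper model at x leaves a function whose
    derivative along the segment from x to y is nonpositive. *)
Lemma lipschitz_descent F (gF : 'rV[R]_d -> 'rV[R]_d) (delta : R) :
  (forall x, has_grad F x (gF x)) ->
  (forall x y, enorm (gF x - gF y) <= delta * enorm (x - y)) ->
  forall x y, F y <= F x + dotp (gF x) (y - x) + delta / 2 * enorm (y - x) ^+ 2.
Proof.
move=> dF lF x y.
pose H z := F z - dotp (gF x) (z - x) - delta / 2 * enorm (z - x) ^+ 2.
have dH z : has_grad H z (gF z - gF x - delta *: (z - x)).
  rewrite [X in X *: (z - x)](_ : _ = 2 * (delta / 2)); last by field.
  apply: has_gradB; last exact: has_grad_sqdist.
  by apply: has_gradB => //; exact: has_grad_dotp.
have [c /andP[c0 c1]] := mean_value x (y - x) (fun z => (dH z).1).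
have Hx : H x = F x by rewrite /H subrr dotp0r enorm0 expr0n /= mulr0 !subr0.
rewrite (dH _).2 [x + (y - x)]addrC subrK Hx /H {Hx}.
rewrite [x + _]addrC addrK dotpDl dotpNl.
set v := y - x => E.
have : dotp (gF (c *: v + x) - gF x) v <= c * delta * enorm v ^+ 2.
  apply: le_trans (dotp_le _ _) _.
  rewrite expr2 mulrA; apply: ler_wpM2r; first exact: enorm_ge0.
  by apply: le_trans (lF _ _) _; rewrite addrK enormZ gtr0_norm // mulrCA mulrA.
by move: E; rewrite !dotpZl -enorm_sqr; lra.
Qed.

End Relatedness.

(** * Minimizers under a quadratic lower bound *)

Section Argmin.
Context {R : realType} {d : nat}.
Implicit Types (F G : 'rV[R]_d -> R) (a b u v w x y : 'rV[R]_d).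

Lemma differentiable_cont F : (forall x, differentiable F x) -> continuous F.
Proof. by move=> dF x; exact: differentiable_continuous. Qed.

(** The quadratic lower bound at u confines the sublevel set of F u to a ball of
    radius enorm b / c, so it is compact and F attains its minimum there. *)
Lemma argmin_exists F b u (c : R) : 0 < c -> continuous F ->
  (forall v, F u + dotp b (v - u) + c * enorm (v - u) ^+ 2 <= F v) ->
  forall y, F (argmin F) <= F y.
Proof.
move=> c0 cF lbF.
suff [x minx] : exists x, forall y, F x <= F y.
  by rewrite /argmin; case: xgetP => [_ -> //|/(_ x)[]].
pose A := [set x | F x <= F u].
have Au : A u by rewrite /A /=.
have cA : compact A.
  apply: bounded_closed_compact; last first.
    apply: (@closed_comp _ _ F [set r | r <= F u]) => [x _|]; last exact: closed_le.
    exact: cF.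
  exists (enorm u + enorm b / c); split; first exact: num_real.
  move=> r hr x Ax /=.
  have xu : enorm (x - u) <= enorm b / c.
    have := lbF x; move: Ax; rewrite /A /= => Ax lb.
    have le1 : c * enorm (x - u) ^+ 2 <= enorm b * enorm (x - u).
      have := dotp_le (- b) (x - u); rewrite dotpNl enormN; lra.
    have [->|n0] := eqVneq (enorm (x - u)) 0.
      by rewrite divr_ge0 // ?enorm_ge0 // ltW.
    have np : 0 < enorm (x - u) by rewrite lt_def n0 enorm_ge0.
    by rewrite ler_pdivlMr // mulrC -(ler_pM2r np) -mulrA.
  rewrite [`|x|]mx_normrE; apply: bigmax_le => [|[i j] _ /=].
    apply: le_trans (ltW hr); rewrite addr_ge0 ?enorm_ge0 // divr_ge0 ?enorm_ge0 //.
    exact: ltW.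
  rewrite (ord1 i); apply: le_trans (ltW hr).
  have -> : x 0 j = u 0 j + (x - u) 0 j by rewrite !mxE; ring.
  apply: le_trans (ler_normD _ _) (lerD _ _); first exact: coord_le_enorm.
  exact: le_trans (coord_le_enorm _ _) xu.
have [|x xA minx] := @EVT_min_rV R d F A (ex_intro _ u Au) cA.
  exact: continuous_subspaceT.
exists x => y; have [Fy|/ltW Fy] := leP (F y) (F u); first by apply: minx; rewrite inE.
by apply: le_trans Fy; apply: minx; rewrite inE.
Qed.

Lemma argmin_grad F (gF : 'rV[R]_d -> 'rV[R]_d) b u (c : R) : 0 < c ->
  (forall x, has_grad F x (gF x)) ->
  (forall v, F u + dotp b (v - u) + c * enorm (v - u) ^+ 2 <= F v) ->
  gF (argmin F) = 0.
Proof.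
move=> c0 dF lbF; have dF' x := (dF x).1.
apply: dotp_eq0; rewrite -(dF (argmin F)).2.
apply: diff_at_min => //; apply: argmin_exists lbF => //.
exact: differentiable_cont.
Qed.

End Argmin.

(** * One proximal step *)

Section Bregman.
Context {R : realType} {d : nat}.
Variables (fb f1 : 'rV[R]_d -> R) (gb g1 : 'rV[R]_d -> 'rV[R]_d).
Variables (delta mu theta : R).
Hypotheses (gbP : forall x, has_grad fb x (gb x)).
Hypotheses (g1P : forall x, has_grad f1 x (g1 x)).
Hypothesis convex_fb : forall x y,
  fb y + dotp (gb y) (x - y) + mu / 2 * enorm (x - y) ^+ 2 <= fb x.
Hypothesis related : forall x y,
  enorm ((g1 x - gb x) - (g1 y - gb y)) <= delta * enorm (x - y).
Hypotheses (mu_gt0 : 0 < mu) (theta_gt0 : 0 < theta).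
Hypothesis delta_theta : delta <= (2 * theta)^-1.

Implicit Types (u v w x y : 'rV[R]_d).

Definition gphi x := g1 x - gb x.

(** The Bregman distance of f1 - fb + |.|^2 / (2 theta), a convex function
    because the gradient of f1 - fb is Lipschitz with constant delta at most
    1 / (2 theta). The proximal step is a mirror step for this distance. *)
Definition bregman v u := f1 v - fb v - (f1 u - fb u) - dotp (gphi u) (v - u)
  + (2 * theta)^-1 * enorm (v - u) ^+ 2.

Let phiP x : has_grad (fun z => f1 z - fb z) x (gphi x).
Proof. exact: has_gradB. Qed.

Lemma related_lower v u : f1 u - fb u + dotp (gphi u) (v - u)
  - delta / 2 * enorm (v - u) ^+ 2 <= f1 v - fb v.
Proof.
have nphiP x : has_grad (fun z => fb z - f1 z) x (- gphi x).
  by rewrite /gphi opprB; exact: has_gradB.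
have := @lipschitz_descent _ _ _ _ delta nphiP _ u v.
rewrite dotpNl => h; suff : forall x y, enorm (- gphi x - - gphi y) <=
  delta * enorm (x - y) by move=> /h; lra.
by move=> x y; rewrite -opprD enormN; exact: related.
Qed.

Lemma bregman_ge v u : (4 * theta)^-1 * enorm (v - u) ^+ 2 <= bregman v u.
Proof.
have := related_lower v u; rewrite /bregman.
have := sqr_ge0 (enorm (v - u)); set E := _ ^+ 2 => E0.
have : delta / 2 * E <= (4 * theta)^-1 * E.
  apply: ler_wpM2r => //; have -> : (4 * theta)^-1 = (2 * theta)^-1 / 2.
    by field; rewrite gt_eqF.
  by rewrite ler_pM2r // invr_gt0.
have -> : (2 * theta)^-1 = (4 * theta)^-1 + (4 * theta)^-1.
  by field; rewrite gt_eqF.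
lra.
Qed.

Lemma bregman_ge0 v u : 0 <= bregman v u.
Proof.
by apply: le_trans (bregman_ge v u); rewrite mulr_ge0 ?sqr_ge0 // invr_ge0 ltW //
  mulr_gt0.
Qed.

Lemma bregman_le v u : bregman v u <= theta^-1 * enorm (v - u) ^+ 2.
Proof.
have := lipschitz_descent phiP related u v; rewrite /bregman.
have := sqr_ge0 (enorm (v - u)); set E := _ ^+ 2 => E0.
have : delta / 2 * E <= (2 * theta)^-1 * E.
  apply: ler_wpM2r => //.
  have : 0 <= (2 * theta)^-1 by rewrite invr_ge0 ltW // mulr_gt0.
  by move: delta_theta; lra.
have -> : theta^-1 = (2 * theta)^-1 + (2 * theta)^-1.
  by field; rewrite gt_eqF.
lra.
Qed.

Lemma enorm_sub_sqr v u : enorm (v - u) ^+ 2 = dotp v v - 2 * dotp v u + dotp u u.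
Proof. by rewrite enorm_sqr !dotpE (dotpC u v); ring. Qed.

Lemma bregman_three_point v u u' :
  dotp (gphi u' - gphi u + theta^-1 *: (u' - u)) (v - u') =
  bregman v u - bregman v u' - bregman u' u.
Proof.
rewrite /bregman !enorm_sub_sqr !dotpE.
rewrite (dotpC u u') (dotpC u v) (dotpC u' v).
by field; rewrite gt_eqF.
Qed.

(** Expanding the square with a Young inequality of parameter 2 theta gives
    (1/2 + 1)^2 = 9/4, since delta <= 1 / (2 theta). *)
Lemma bregman_grad_le x u : enorm (gphi x - gphi u + theta^-1 *: (x - u)) ^+ 2 <=
  9 / 4 * theta^-1 ^+ 2 * enorm (x - u) ^+ 2.
Proof.
set a := gphi x - gphi u; set b := x - u.
have ha : enorm a ^+ 2 <= (theta^-1 / 2) ^+ 2 * enorm b ^+ 2.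
  rewrite -exprMn; apply: lerXn2r; rewrite ?nnegrE ?enorm_ge0 //.
    by rewrite mulr_ge0 ?enorm_ge0 // divr_ge0 // invr_ge0 ltW.
  apply: le_trans (related _ _) _; apply: ler_wpM2r; first exact: enorm_ge0.
  suff -> : theta^-1 / 2 = (2 * theta)^-1 by [].
  by field; rewrite gt_eqF.
clearbody a b; have := @dotp_young _ _ (2 * theta) a b (mulr_gt0 (ltr0Sn R 1) theta_gt0).
rewrite -!enorm_sqr.
have -> : enorm (a + theta^-1 *: b) ^+ 2 =
    enorm a ^+ 2 + 2 * theta^-1 * dotp a b + theta^-1 ^+ 2 * enorm b ^+ 2.
  by rewrite !enorm_sqr !dotpE (dotpC b a); ring.
have t0 : 0 < theta^-1 by rewrite invr_gt0.
have -> : 2 * theta / 2 = theta by field.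
have -> : (2 * (2 * theta))^-1 = theta^-1 / 4 by field; rewrite gt_eqF.
move=> /(ler_wpM2l (ltW t0)); rewrite mulrDr mulrA mulVf ?gt_eqF // mul1r.
move: ha; rewrite !expr2; nra.
Qed.

Section Step.
Variables (xs yk : 'rV[R]_d) (tau fs : R).
Hypothesis tau01 : 0 <= tau <= 1.

(** Acceleration comes from comparing a step with the minimizer xs and the
    previous output yk at the same time, with weights tau and 1 - tau. *)
Definition mixed_point := tau *: xs + (1 - tau) *: yk.
Definition mixed_bregman u := tau * bregman xs u + (1 - tau) * bregman yk u.

Lemma mixed_bregman_ge0 u : 0 <= mixed_bregman u.
Proof.
move/andP: tau01 => [t0 t1].
by rewrite addr_ge0 // mulr_ge0 ?bregman_ge0 // subr_ge0.
Qed.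

Lemma dotp_mixed_point w u : dotp w (mixed_point - u) =
  tau * dotp w (xs - u) + (1 - tau) * dotp w (yk - u).
Proof. by rewrite /mixed_point !dotpE; ring. Qed.

(** Strong convexity of fb at u', where the optimality condition of the step
    replaces the gradient of fb by that of the Bregman distance, up to the error
    s + gphi u of the estimated gradient; then the three-point identity. *)
Lemma prox_step s u u' v :
  s + theta^-1 *: (u' - u) + g1 u' = 0 ->
  fb u' + bregman v u' + bregman u' u + mu / 2 * enorm (v - u') ^+ 2 <=
  fb v + bregman v u + dotp (s + gphi u) (v - u').
Proof.
move=> opt; have := convex_fb v u'.
have -> : gb u' = - (s + gphi u) - (gphi u' - gphi u + theta^-1 *: (u' - u)).
  apply/eqP; rewrite -subr_eq0 -[X in _ == X]opt /gphi; apply/eqP.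
  apply/rowP => i; rewrite !mxE; ring.
rewrite (dotpDl (- _)) dotpNl [dotp (- (_ + _ *: _)) _]dotpNl bregman_three_point; lra.
Qed.

(** The error multiplies v - u', which depends on it: splitting off u - u' costs
    theta |e|^2 and is absorbed by the distance from u' to u. What remains pairs
    the error with the mixed point minus u, which does not depend on it. Both
    terms are kept in one square, so that bounding its expectation takes care of
    the pairing, whose mean is zero. *)
Lemma epoch_step_bound s u u' :
  s + theta^-1 *: (u' - u) + g1 u' = 0 ->
  (fb u' - fs) + mixed_bregman u' + tau * mu / 2 * enorm (xs - u') ^+ 2
    + (4 * theta)^-1 * enorm (mixed_point - u) ^+ 2 <=
  (1 - tau) * (fb yk - fs) + tau * (fb xs - fs) + mixed_bregman u
    + theta * enorm (s + gphi u + (2 * theta)^-1 *: (mixed_point - u)) ^+ 2.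
Proof.
move=> opt; have := prox_step xs opt; have := prox_step yk opt.
move/andP: tau01 => [t0 t1].
set e := s + gphi u => hy hx.
have hy' : fb u' + bregman yk u' + bregman u' u <=
  fb yk + bregman yk u + dotp e (yk - u').
  apply: le_trans hy; rewrite lerDl mulr_ge0 ?sqr_ge0 // divr_ge0 // ltW //.
have := lerD (ler_wpM2l t0 hx) (ler_wpM2l (_ : 0 <= 1 - tau) hy').
rewrite subr_ge0 => /(_ t1).
have hW := dotp_mixed_point e u'.
have -> : theta * enorm (e + (2 * theta)^-1 *: (mixed_point - u)) ^+ 2 =
  theta * enorm e ^+ 2 + dotp e (mixed_point - u)
  + (4 * theta)^-1 * enorm (mixed_point - u) ^+ 2.
  move: (mixed_point - u) => w; clearbody e.
  by rewrite !enorm_sqr !dotpE (dotpC w e); field; rewrite gt_eqF.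
have hb := bregman_ge u' u.
have th2 : 0 < 2 * theta by rewrite mulr_gt0.
have := dotp_young e (u - u') th2.
have -> : 2 * theta / 2 = theta by field.
have -> : (2 * (2 * theta))^-1 = (4 * theta)^-1.
  by congr (_^-1); ring.
rewrite -!enorm_sqr -(enormN (u - u')) opprB.
have -> : dotp e (u - u') = dotp e (mixed_point - u') - dotp e (mixed_point - u).
  by rewrite !dotpE; ring.
rewrite hW /mixed_bregman; lra.
Qed.

End Step.

Section Potential.
Variables (xs yk zk : 'rV[R]_d) (tau fs p alpha : R).
Hypotheses (tau01 : 0 < tau <= 1) (p_gt0 : 0 < p) (alpha_gt0 : 0 < alpha).
Hypothesis tau_alpha : tau * alpha = theta / (8 * p).

Local Notation x := (tau *: zk + (1 - tau) *: yk).
Local Notation Dm := (mixed_bregman xs yk tau).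

(** G is p times the difference of the Bregman gradients at x and u, so the
    three-point identity evaluates its product with xs - zk: the
    coupling x = tau zk + (1 - tau) yk turns tau (xs - zk) into the mixed point
    minus x. The decrease p/(4 theta) = 16/64 p/theta of the square distance
    between x and u pays 9/64 for the square of G and leaves 7/64. *)
Lemma potential_bound u z' :
  let G := p *: (gphi x - gphi u + theta^-1 *: (x - u)) in
  alpha^-1 *: (z' - zk) + G + mu *: (z' - u) = 0 ->
  fb u - fs + tau * ((2 * alpha)^-1 + mu / 2) * enorm (z' - xs) ^+ 2 <=
  fb u - fs + tau * mu / 2 * enorm (xs - u) ^+ 2 + p * Dm u - p * Dm x
  - 7 / 64 * p / theta * enorm (x - u) ^+ 2
  + tau / (2 * alpha) * enorm (xs - zk) ^+ 2.
Proof.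
move=> G opt; have [t0 t1] := andP tau01.
have t0' : 0 <= tau <= 1 by rewrite ltW.
(* Strong convexity of the quadratic minimized by z', which is exact. *)
have three : (alpha^-1 + mu) / 2 * enorm (z' - xs) ^+ 2 =
    alpha^-1 / 2 * enorm (xs - zk) ^+ 2 + mu / 2 * enorm (xs - u) ^+ 2
    + dotp G (xs - z') - alpha^-1 / 2 * enorm (z' - zk) ^+ 2
    - mu / 2 * enorm (z' - u) ^+ 2.
  have -> : G = - (alpha^-1 *: (z' - zk)) - mu *: (z' - u).
    by move/eqP: opt; rewrite addrAC addrC addr_eq0 => /eqP ->; rewrite opprD.
  set X := xs - z'; set a := z' - zk; set b := z' - u.
  have -> : z' - xs = - X by rewrite opprB.
  have -> : xs - zk = X + a by rewrite addrA subrK.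
  have -> : xs - u = X + b by rewrite addrA subrK.
  by clearbody X a b; rewrite !enorm_sqr !dotpE (dotpC a X) (dotpC b X); field; rewrite gt_eqF.
have hG : enorm G ^+ 2 <= p ^+ 2 * (9 / 4 * theta^-1 ^+ 2 * enorm (x - u) ^+ 2).
  rewrite enormZ exprMn real_normK ?num_real //.
  by apply: ler_wpM2l; [exact: sqr_ge0|exact: bregman_grad_le].
have hD : tau * dotp G (xs - zk) = p * Dm u - p * Dm x - p * bregman x u.
  rewrite /G dotpZl mulrCA -dotpZr.
  have -> : tau *: (xs - zk) = mixed_point xs yk tau - x.
    by apply/rowP => i; rewrite /mixed_point !mxE; ring.
  rewrite dotp_mixed_point.
  have tp v : dotp (gphi x - gphi u + theta^-1 *: (x - u)) (v - x) =
    bregman v u - bregman v x - bregman x u by exact: bregman_three_point.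
  rewrite !tp /mixed_bregman; ring.
have hb := ler_wpM2l (ltW p_gt0) (bregman_ge x u).
have hy := dotp_young G (zk - z') alpha_gt0.
rewrite -!enorm_sqr -(enormN (zk - z')) opprB in hy.
have hG' : tau * (alpha / 2 * enorm G ^+ 2) <= 9 / 64 * p / theta * enorm (x - u) ^+ 2.
  rewrite (mulrA tau) (mulrA tau) tau_alpha.
  have -> : theta / (8 * p) / 2 = (theta / (16 * p)) by field; rewrite gt_eqF.
  have k0 : 0 <= theta / (16 * p) by rewrite divr_ge0 ?mulr_ge0 // ltW.
  apply: le_trans (ler_wpM2l k0 hG) _; rewrite le_eqVlt; apply/orP; left.
  by apply/eqP; field; rewrite !gt_eqF.
have hy' := ler_wpM2l (ltW t0) hy.
have e2 : (2 * alpha)^-1 = alpha^-1 / 2 by field; rewrite gt_eqF.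
have e4 : p * ((4 * theta)^-1 * enorm (x - u) ^+ 2) =
  16 / 64 * p / theta * enorm (x - u) ^+ 2 by field; rewrite gt_eqF.
have e5 : dotp G (xs - z') = dotp G (xs - zk) + dotp G (zk - z').
  by rewrite !dotpE; ring.
rewrite e2 in hy'.
have three' := congr1 (fun r => tau * r) three; rewrite /= e5 in three'.
rewrite e2.
have q0 : 0 <= tau * (mu / 2 * enorm (z' - u) ^+ 2).
  by rewrite mulr_ge0 ?(ltW t0) // mulr_ge0 ?sqr_ge0 // divr_ge0 // ltW.
move: hD hb hG' hy' three' q0; rewrite e4.
set G2 := enorm G ^+ 2; set E := enorm (x - u) ^+ 2.
lra.
Qed.

End Potential.

(** The loss f1 need not be convex; the quadratic term makes up for its distance
    to the convex fb. *)
Lemma prox_existence s u :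
  let F v := dotp s (v - u) + (2 * theta)^-1 * enorm (v - u) ^+ 2 + f1 v in
  s + theta^-1 *: (argmin F - u) + g1 (argmin F) = 0.
Proof.
move=> F.
have FP v : has_grad F v (s + theta^-1 *: (v - u) + g1 v).
  rewrite (_ : theta^-1 = 2 * (2 * theta)^-1); last by field; rewrite gt_eqF.
  apply: has_gradD => //; apply: has_gradD; first exact: has_grad_dotp.
  exact: has_grad_sqdist.
apply: (@argmin_grad _ _ F (fun v => s + theta^-1 *: (v - u) + g1 v) (s + g1 u) u (mu / 2)) => //; first exact: divr_gt0.
move=> v; have := convex_fb v u; have := related_lower v u.
rewrite /F subrr dotp0r enorm0 expr0n /= mulr0 !add0r /gphi !dotpDl dotpNl.
have := sqr_ge0 (enorm (v - u)); set E := _ ^+ 2 => E0.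
have : delta / 2 * E <= (2 * theta)^-1 * E.
  apply: ler_wpM2r => //.
  have : 0 <= (2 * theta)^-1 by rewrite invr_ge0 ltW // mulr_gt0.
  by move: delta_theta; lra.
lra.
Qed.

(** The operator sending a to a / theta + g1 a is strongly monotone, being the sum
    of the monotone gb and of the identity over theta plus gphi, where gphi is Lipschitz
    with constant at most half of 1 / theta. *)
Lemma resolvent_contraction a b : enorm (a - b) <=
  2 * theta * enorm (theta^-1 *: a + g1 a - (theta^-1 *: b + g1 b)).
Proof.
have [->|n0] := eqVneq (enorm (a - b)) 0.
  by rewrite mulr_ge0 ?enorm_ge0 // mulr_ge0 // ltW.
have np : 0 < enorm (a - b) by rewrite lt_def n0 enorm_ge0.
have th2 : 0 < 2 * theta by rewrite mulr_gt0.
rewrite -ler_pdivrMl // -(ler_pM2r np).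
apply: le_trans (dotp_le _ _).
have -> : theta^-1 *: a + g1 a - (theta^-1 *: b + g1 b) =
    theta^-1 *: (a - b) + (gb a - gb b) + (gphi a - gphi b).
  by apply/rowP => i; rewrite /gphi !mxE; ring.
rewrite dotpDl (dotpDl (_ *: _)) dotpZl -enorm_sqr.
have mono : 0 <= dotp (gb a - gb b) (a - b).
  have := convex_fb a b; have := convex_fb b a.
  rewrite -(enormN (b - a)) opprB -(opprB a b) dotpNr dotpDl dotpNl.
  have : 0 <= mu / 2 * enorm (a - b) ^+ 2.
    by rewrite mulr_ge0 ?sqr_ge0 // divr_ge0 // ltW.
  lra.
have : - dotp (gphi a - gphi b) (a - b) <= (2 * theta)^-1 * enorm (a - b) ^+ 2.
  rewrite -dotpNl; apply: le_trans (dotp_le _ _) _.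
  rewrite enormN expr2 mulrA; apply: ler_wpM2r; first exact: enorm_ge0.
  apply: le_trans (related _ _) _; apply: ler_wpM2r => //; exact: enorm_ge0.
have -> : theta^-1 = (2 * theta)^-1 + (2 * theta)^-1 by field; rewrite gt_eqF.
rewrite -mulrA -expr2; lra.
Qed.

End Bregman.

(** * One iteration for fixed seeds *)

Section Olga.
Context {R : realType} {d M : nat} {X : Type}.
Variables (f : 'I_M -> 'rV[R]_d -> R) (server : 'I_M).
Variable Q : X -> 'rV[R]_d -> 'rV[R]_d.
Variables (delta mu theta : R).
Hypothesis f_smooth : forall m, twice_differentiable (f m).
Hypothesis f_related : delta_related f delta.
Hypothesis f_convex : strongly_convex mu (favg f).
Hypotheses (delta_gt0 : 0 < delta) (mu_gt0 : 0 < mu) (theta_gt0 : 0 < theta).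
Hypothesis delta_theta : delta <= (2 * theta)^-1.

Local Notation fb := (favg f).
Local Notation f1 := (f server).
Implicit Types (u v x y : 'rV[R]_d).

Let M_neq0 : M%:R != 0 :> R.
Proof. by rewrite pnatr_eq0; case: M server => [[]|]. Qed.

Lemma has_grad_loss m x : has_grad (f m) x (grad (f m) x).
Proof. by apply: has_grad_grad; case: (f_smooth m x). Qed.

Lemma favgE : fb = (fun x => M%:R^-1 * \sum_(m <- index_enum 'I_M) f m x).
Proof. by []. Qed.

Lemma grad_favgE x : grad fb x = M%:R^-1 *: \sum_(m < M) grad (f m) x.
Proof.
apply: has_gradE; rewrite favgE; apply: has_gradZ; apply: has_grad_sum => m.
exact: has_grad_loss.
Qed.

Lemma has_grad_favg x : has_grad fb x (grad fb x).
Proof.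
rewrite grad_favgE favgE; apply: has_gradZ; apply: has_grad_sum => m.
exact: has_grad_loss.
Qed.

Lemma twice_differentiable_favg : twice_differentiable fb.
Proof.
move=> x; split; first by case: (has_grad_favg x).
have -> : grad fb = M%:R^-1 *: (\sum_(m < M) grad (f m)).
  by rewrite funeqE => y; rewrite grad_favgE /= fctE fct_sumE.
apply: differentiableZ; apply: differentiable_sum => m.
by case: (f_smooth m x).
Qed.

Lemma grad_related m x y :
  enorm ((grad (f m) x - grad fb x) - (grad (f m) y - grad fb y)) <=
  delta * enorm (x - y).
Proof.
apply: jacobian_diff_lipschitz => [|z|z|z]; first exact: ltW.
- by case: (f_smooth m z).
- by case: (twice_differentiable_favg z).
- exact: f_related.
Qed.

Lemma grad_continuous m : continuous (grad (f m)).
Proof. by move=> x; apply: differentiable_continuous; case: (f_smooth m x). Qed.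

Lemma grad_favg_continuous : continuous (grad fb).
Proof.
by move=> x; apply: differentiable_continuous; case: (twice_differentiable_favg x).
Qed.

Lemma favg_continuous : continuous fb.
Proof. by apply: differentiable_cont => x; case: (has_grad_favg x). Qed.

(** The vector compressed by node m. *)
Definition drift m u0 u := grad (f m) u - grad f1 u - grad (f m) u0 + grad f1 u0.

(** The drift is the increment of the gradient of f m - favg f minus that of the
    gradient of f1 - favg f, each at most delta times the distance. *)
Lemma drift_sqr_le m u0 u :
  enorm (drift m u0 u) ^+ 2 <= 4 * delta ^+ 2 * enorm (u - u0) ^+ 2.
Proof.
set a := (grad (f m) u - grad fb u) - (grad (f m) u0 - grad fb u0).
set b := (grad f1 u - grad fb u) - (grad f1 u0 - grad fb u0).
have -> : drift m u0 u = a - b.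
  by apply/rowP => i; rewrite /drift /a /b !mxE; ring.
have sq m' : enorm ((grad (f m') u - grad fb u) - (grad (f m') u0 - grad fb u0)) ^+ 2
    <= delta ^+ 2 * enorm (u - u0) ^+ 2.
  rewrite -exprMn; apply: lerXn2r; rewrite ?nnegrE ?enorm_ge0 //.
    by rewrite mulr_ge0 ?enorm_ge0 // ltW.
  exact: grad_related.
have := sq m; have := sq server; rewrite -/a -/b; clearbody a b.
have := dotp_ge0 (a + b); rewrite !enorm_sqr !dotpE (dotpC b a); lra.
Qed.

Definition gradient_estimate (g : 'I_M -> 'rV[R]_d) u0 :=
  M%:R^-1 *: (\sum_(m < M) g m) - grad f1 u0 + grad fb u0.

Lemma epoch_stepE s u0 u : epoch_step f server Q theta s u0 u =
  argmin (fun v => dotp (gradient_estimate (fun m => Q (s m) (drift m u0 u)) u0) (v - u)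
                   + (2 * theta)^-1 * enorm (v - u) ^+ 2 + f1 v).
Proof. by []. Qed.

Lemma epoch_step_optimal s u0 u :
  gradient_estimate (fun m => Q (s m) (drift m u0 u)) u0
  + theta^-1 *: (epoch_step f server Q theta s u0 u - u)
  + grad f1 (epoch_step f server Q theta s u0 u) = 0.
Proof.
rewrite epoch_stepE.
apply: (@prox_existence _ _ fb f1 (grad fb) (grad f1) delta mu theta) => //.
- exact: has_grad_favg.
- exact: has_grad_loss.
- exact: grad_related.
Qed.

(** The drifts average to the change of the gradient of favg f - f1, so only the
    compression errors remain. *)
Lemma gradient_estimate_error g u0 u :
  gradient_estimate g u0 + gphi (grad fb) (grad f1) u =
  \sum_(m < M) M%:R^-1 *: (g m - drift m u0 u).
Proof.
rewrite -scaler_sumr sumrB /gradient_estimate scalerBr -!addrA; congr (_ + _).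
have -> : M%:R^-1 *: (\sum_(m < M) drift m u0 u) =
    grad fb u - grad f1 u - grad fb u0 + grad f1 u0.
  have avg (a b : 'I_M -> 'rV[R]_d) c c' :
      M%:R^-1 *: (\sum_(m < M) (a m - c - b m + c')) =
      M%:R^-1 *: (\sum_(m < M) a m) - c - M%:R^-1 *: (\sum_(m < M) b m) + c'.
    rewrite !big_split /= !sumrN !sumr_const card_ord !scalerDr !scalerN.
    by rewrite -(scaler_nat _ c) -(scaler_nat _ c') !scalerA mulVf // !scale1r.
  apply: (etrans (avg _ _ _ _)).
  by rewrite (grad_favgE u) (grad_favgE u0).
by rewrite /gphi; apply/rowP => i; rewrite !mxE; ring.
Qed.

(** The steps are minimizers, for which measurability is not immediate; they are
    continuous functions of the data through this resolvent of grad f1. *)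
Definition resolvent r := argmin (fun v : 'rV[R]_d => dotp (- r) (v - 0)
  + (2 * theta)^-1 * enorm (v - 0) ^+ 2 + f1 v).

Lemma resolventP r : theta^-1 *: resolvent r + grad f1 (resolvent r) = r.
Proof.
have := @prox_existence _ _ fb f1 (grad fb) (grad f1) delta mu theta
  has_grad_favg (has_grad_loss server) (fun x y => f_convex x y)
  (grad_related server) mu_gt0 theta_gt0 delta_theta (- r) 0.
rewrite /= -/(resolvent r) => /eqP.
by rewrite (subr0 (resolvent r)) -addrA addrC subr_eq0 => /eqP.
Qed.

Lemma resolvent_unique r a : theta^-1 *: a + grad f1 a = r -> a = resolvent r.
Proof.
move=> ar; apply/eqP; rewrite -subr_eq0; apply/eqP/enorm0_eq0.
have := @resolvent_contraction _ _ fb (grad fb) (grad f1) delta mu theta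
  (fun x y => f_convex x y)
  (grad_related server) mu_gt0 theta_gt0 delta_theta a (resolvent r).
rewrite resolventP ar subrr enorm0 mulr0 => h.
by apply/eqP; rewrite eq_le h enorm_ge0.
Qed.

Lemma resolvent_continuous : continuous resolvent.
Proof.
have lip a b : enorm (resolvent a - resolvent b) <= 2 * theta * enorm (a - b).
  have := @resolvent_contraction _ _ fb (grad fb) (grad f1) delta mu theta
    (fun x y => f_convex x y)
    (grad_related server) mu_gt0 theta_gt0 delta_theta (resolvent a) (resolvent b).
  by rewrite !resolventP.
move=> b.
have H := (@cvgrPdist_le R 'rV[R]_d 'rV[R]_d (nbhs b) _ resolvent (resolvent b)).2.
apply: H => e e0.
have c0 : 0 < (e / (2 * theta)) ^+ 2 by rewrite exprn_gt0 // divr_gt0 // mulr_gt0.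
have : \forall a \near b, 1 * enorm (a - b) ^+ 2 < (e / (2 * theta)) ^+ 2.
  have /differentiable_continuous := (has_grad_sqdist 1 b b).1.
  move=> /cvgr_lt; apply; by rewrite subrr enorm0 expr0n /= mulr0.
apply: filterS => a; rewrite mul1r => ab.
apply: le_trans (mx_norm_le_enorm _) _; apply: le_trans (lip _ _) _.
rewrite -(enormN (b - a)) opprB mulrC -ler_pdivlMr ?mulr_gt0 //.
rewrite -[leRHS]gtr0_norm ?divr_gt0 ?mulr_gt0 // -sqrtr_sqr -[leLHS]ger0_norm ?enorm_ge0 //.
by rewrite -sqrtr_sqr ler_wsqrtr // ltW.
Qed.

Lemma epoch_step_resolvent s u0 u : epoch_step f server Q theta s u0 u =
  resolvent (theta^-1 *: u - gradient_estimate (fun m => Q (s m) (drift m u0 u)) u0).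
Proof.
apply: resolvent_unique; have := epoch_step_optimal s u0 u.
have rearrange (a b c e : 'rV[R]_d) : a + (b - c) + e = 0 -> b + e = c - a.
  move=> h; apply/rowP => i; have := congr1 (fun v : 'rV[R]_d => v 0 i) h.
  rewrite !mxE; lra.
by rewrite scalerBr => /rearrange.
Qed.

Lemma quadratic_argmin (alpha : R) (zk G y : 'rV[R]_d) : 0 < alpha ->
  let z := argmin (fun v => (2 * alpha)^-1 * enorm (v - zk) ^+ 2
                   + dotp G v + mu / 2 * enorm (v - y) ^+ 2) in
  alpha^-1 *: (z - zk) + G + mu *: (z - y) = 0.
Proof.
move=> alpha_gt0 z.
pose F v := (2 * alpha)^-1 * enorm (v - zk) ^+ 2 + dotp G (v - 0) + mu / 2 * enorm (v - y) ^+ 2.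
have zE : z = argmin F by congr argmin; rewrite funeqE => v; rewrite /F subr0.
have dF v : has_grad F v (alpha^-1 *: (v - zk) + G + mu *: (v - y)).
  rewrite (_ : alpha^-1 = 2 * (2 * alpha)^-1); last by field; rewrite gt_eqF.
  rewrite (_ : mu *: _ = (2 * (mu / 2)) *: (v - y)); last by congr (_ *: _); field.
  apply: has_gradD; last exact: has_grad_sqdist.
  by apply: has_gradD; [exact: has_grad_sqdist|exact: has_grad_dotp].
rewrite zE; apply: (@argmin_grad _ _ F (fun v => alpha^-1 *: (v - zk) + G + mu *: (v - y))
  (G + mu *: (zk - y)) zk (mu / 2)) => //; first exact: divr_gt0.
move=> v; rewrite /F !subr0 subrr enorm0 expr0n /= mulr0 add0r.
have -> : v - y = (v - zk) + (zk - y) by rewrite addrA subrK.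
have -> : dotp G v = dotp G (v - zk) + dotp G zk by rewrite -dotpDr subrK.
move: (v - zk) (zk - y) => a b.
rewrite !enorm_sqr !dotpE (dotpC b a).
have := dotp_ge0 a; have : 0 < (2 * alpha)^-1 by rewrite invr_gt0 mulr_gt0.
nra.
Qed.

Section Iteration.
Variables (xs : 'rV[R]_d) (p tau alpha : R).
Hypothesis xs_min : forall x, fb xs <= fb x.
Hypotheses (tau01 : 0 < tau <= 1) (p_gt0 : 0 < p) (alpha_gt0 : 0 < alpha).
Hypothesis tau_alpha : tau * alpha = theta / (8 * p).

Definition mixed yk u := mixed_bregman fb f1 (grad fb) (grad f1) theta xs yk tau u.

(** The Lyapunov function that an iteration contracts in expectation. *)
Definition potential (yz : 'rV[R]_d * 'rV[R]_d) := fb yz.1 - fb xs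
  + tau * ((2 * alpha)^-1 + mu / 2) * enorm (yz.2 - xs) ^+ 2.

Let tau01' : 0 <= tau <= 1.
Proof. by have [t0 ->] := andP tau01; rewrite ltW. Qed.

Let bregman_lower := bregman_ge has_grad_favg (has_grad_loss server)
  (grad_related server) theta_gt0 delta_theta.

Lemma mixed_ge0 yk u : 0 <= mixed yk u.
Proof.
exact: (mixed_bregman_ge0 has_grad_favg (has_grad_loss server)
  (grad_related server) theta_gt0 delta_theta).
Qed.

Lemma mixed_ge yk u : tau / (4 * theta) * enorm (xs - u) ^+ 2 <= mixed yk u.
Proof.
have [t0 t1] := andP tau01'.
have h1 := ler_wpM2l t0 (bregman_lower xs u).
have h2 : 0 <= (1 - tau) * bregman fb f1 (grad fb) (grad f1) theta yk u.
  rewrite mulr_ge0 ?subr_ge0 //; apply: le_trans (bregman_lower yk u).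
  by rewrite mulr_ge0 ?sqr_ge0 // invr_ge0 ltW // mulr_gt0.
rewrite /mixed /mixed_bregman -mulrA; lra.
Qed.

Lemma mixed_le yk u : mixed yk u <=
  theta^-1 * (enorm (xs - u) ^+ 2 + enorm (yk - u) ^+ 2).
Proof.
have [t0 t1] := andP tau01'; have t1' : 0 <= 1 - tau by rewrite subr_ge0.
have up v : bregman fb f1 (grad fb) (grad f1) theta v u <=
    theta^-1 * enorm (v - u) ^+ 2.
  exact: (bregman_le has_grad_favg (has_grad_loss server)
    (grad_related server) theta_gt0 delta_theta).
have q v : 0 <= theta^-1 * enorm (v - u) ^+ 2.
  by rewrite mulr_ge0 ?sqr_ge0 // invr_ge0 ltW.
have h1 := ler_wpM2l t0 (up xs); have h2 := ler_wpM2l t1' (up yk).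
have l1 := ler_piMl (q xs) t1; have l2 := ler_piMl (q yk) (_ : 1 - tau <= 1).
rewrite lerBlDr lerDl in l2; have {}l2 := l2 t0.
rewrite [leRHS]mulrDr; apply: lerD; [exact: le_trans l1|exact: le_trans l2].
Qed.

Lemma favg_growth y : mu / 2 * enorm (y - xs) ^+ 2 <= fb y - fb xs.
Proof.
have := f_convex y xs.
have -> : dotp (grad fb xs) (y - xs) = 0.
  rewrite -(has_grad_favg xs).2; apply: diff_at_min => // z.
  by case: (has_grad_favg z).
rewrite addr0; lra.
Qed.

Lemma potential_ge0 yz : 0 <= potential yz.
Proof.
have [t0 _] := andP tau01'.
rewrite addr_ge0 ?subr_ge0 // mulr_ge0 ?sqr_ge0 // mulr_ge0 //.
by rewrite addr_ge0 // ?divr_ge0 ?invr_ge0 ?mulr_ge0 // ltW.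
Qed.

Lemma path_step (s : 'I_M -> X) u0 u u' yk :
  u' = epoch_step f server Q theta s u0 u ->
  (fb u' - fb xs) + mixed yk u' + tau * mu / 2 * enorm (xs - u') ^+ 2
    + (4 * theta)^-1 * enorm (mixed_point xs yk tau - u) ^+ 2 <=
  (1 - tau) * (fb yk - fb xs) + mixed yk u
    + theta * enorm (\sum_(m < M) M%:R^-1 *: (Q (s m) (drift m u0 u) - drift m u0 u)
        + (2 * theta)^-1 *: (mixed_point xs yk tau - u)) ^+ 2.
Proof.
move=> u'E.
have := epoch_step_bound has_grad_favg (has_grad_loss server)
  (fun x y => f_convex x y) (grad_related server) mu_gt0 theta_gt0 delta_theta
  xs yk (fb xs) tau01' (epoch_step_optimal s u0 u).
rewrite (gradient_estimate_error (fun m => Q (s m) (drift m u0 u)) u0 u).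
by rewrite -u'E -!/(mixed _ _) (subrr (fb xs)) mulr0 addr0.
Qed.

Lemma olga_step_optimal n s (yz : 'rV[R]_d * 'rV[R]_d) :
  let x := olga_x tau yz in
  let yz' := olga_step f server Q mu p theta tau alpha n s yz in
  alpha^-1 *: (yz'.2 - yz.2)
  + p *: (gphi (grad fb) (grad f1) x - gphi (grad fb) (grad f1) yz'.1
          + theta^-1 *: (x - yz'.1))
  + mu *: (yz'.2 - yz'.1) = 0.
Proof. by move=> x yz'; exact: quadratic_argmin. Qed.

Lemma path_potential n s (yz yz' : 'rV[R]_d * 'rV[R]_d) x :
  x = olga_x tau yz -> yz' = olga_step f server Q mu p theta tau alpha n s yz ->
  potential yz' + p * mixed yz.1 x + 7 / 64 * p / theta * enorm (x - yz'.1) ^+ 2 <=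
  (fb yz'.1 - fb xs + tau * mu / 2 * enorm (xs - yz'.1) ^+ 2)
  + p * mixed yz.1 yz'.1 + tau / (2 * alpha) * enorm (xs - yz.2) ^+ 2.
Proof.
move=> xE yz'E.
have := potential_bound has_grad_favg (has_grad_loss server)
  (grad_related server) mu_gt0 theta_gt0 delta_theta
  xs (fb xs) tau01 p_gt0 alpha_gt0 tau_alpha (olga_step_optimal n s yz).
rewrite -/(olga_x tau yz) -xE -yz'E -!/(mixed _ _) /potential; lra.
Qed.

(** The explicit form of z, which shows that it depends measurably on the
    randomness. *)
Lemma olga_step_z n s (yz : 'rV[R]_d * 'rV[R]_d) :
  let x := olga_x tau yz in
  let yz' := olga_step f server Q mu p theta tau alpha n s yz in
  yz'.2 = (alpha^-1 + mu)^-1 *: (alpha^-1 *: yz.2 + mu *: yz'.1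
    - p *: (gphi (grad fb) (grad f1) x - gphi (grad fb) (grad f1) yz'.1
          + theta^-1 *: (x - yz'.1))).
Proof.
move=> x yz'; set G := p *: _.
have : alpha^-1 *: (yz'.2 - yz.2) + G + mu *: (yz'.2 - yz'.1) = 0.
  exact: olga_step_optimal.
clearbody G; move: yz'.2 yz'.1 => z' y'.
have c0 : alpha^-1 + mu != 0 by rewrite gt_eqF // addr_gt0 // invr_gt0.
move=> h; apply: (scalerI c0); rewrite scalerA divff // scale1r.
apply/rowP => i; have := congr1 (fun v : 'rV[R]_d => v 0 i) h.
rewrite !mxE; lra.
Qed.

End Iteration.

End Olga.

(** * Random vectors and compressors *)

Section RandomVectors.
Context {R : realType} {d : nat} {dT : measure_display} {T : measurableType dT}.
Implicit Types (U W : T -> 'rV[R]_d).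

Definition measurable_vector U :=
  forall i, measurable_fun [set: T] (fun w => U w 0 i).

(** An open set is the union of the cubes with rational center and radius 1 / n
    that it contains, and there are countably many of these. *)
Lemma measurable_vector_open U (A : set 'rV[R]_d) : measurable_vector U ->
  open A -> measurable (U @^-1` A).
Proof.
move=> mU oA.
pose box (qn : 'rV[rat]_d * nat) : set 'rV[R]_d :=
  [set x : 'rV[R]_d | forall i, ball (ratr (qn.1 0 i) : R) qn.2.+1%:R^-1 (x 0 i)].
pose F qn : set T := if `[< box qn `<=` A >] then U @^-1` box qn else set0.
have -> : U @^-1` A = \bigcup_qn F qn.
  rewrite eqEsubset; split => w; last first.
    by move=> [qn _]; rewrite /F; case: asboolP => // qnA /qnA.
  move=> Aw; have /nbhs_ballP[e /= e0 eA] := oA _ Aw.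
  pose n := Num.truncn (2 / e).
  have ne : n.+1%:R^-1 < e / 2.
    rewrite invf_plt ?posrE ?divr_gt0 // invf_div.
    exact: truncnS_gt.
  have n0 : 0 < n.+1%:R^-1 :> R by rewrite invr_gt0.
  have qP i : exists q : rat, ball (U w 0 i) n.+1%:R^-1 (ratr q : R).
    have /rat_in_itvoo[q] : U w 0 i - n.+1%:R^-1 < U w 0 i + n.+1%:R^-1.
      by rewrite ltrD2l gtrN.
    rewrite in_itv /= => /andP[q1 q2]; exists q.
    rewrite /ball /= ltr_norml; move: (n.+1%:R^-1) q1 q2 => c q1 q2.
    by apply/andP; split; lra.
  have {qP}[q qP] := choice qP.
  exists (\row_i q i, n) => //; rewrite /F; case: asboolP => [_ i|[]].
    by rewrite mxE; exact/ball_sym/qP.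
  move=> x xq; apply: eA; split => // i j; rewrite (ord1 i).
  have := ball_triangle (qP j) (_ : ball (ratr (q j) : R) _ (x 0 j)).
  move=> /(_ n.+1%:R^-1); have := xq j; rewrite /= mxE => h /(_ h).
  by apply: le_ball; move: (n.+1%:R^-1) ne => c; lra.
apply: countable_bigcupT_measurable => [|qn]; first exact: countableP.
rewrite /F; case: asboolP => // _.
have -> : U @^-1` box qn = \bigcap_(i in [set` index_enum 'I_d])
    ((fun w => U w 0 i) @^-1` ball (ratr (qn.1 0 i) : R) qn.2.+1%:R^-1).
  rewrite eqEsubset; split => w; first by move=> h i _; exact: h.
  by move=> h i; apply: h => /=; exact: mem_index_enum.
rewrite bigcap_seq; apply: bigsetI_measurable => i _.
rewrite -[X in measurable X]setTI; apply: mU => //; exact: measurable_ball.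
Qed.

Lemma continuous_measurable U (g : 'rV[R]_d -> R) : measurable_vector U ->
  continuous g -> measurable_fun [set: T] (g \o U).
Proof.
move=> mU cg; apply: (measurability _ (RGenOInfty.measurableE R)).
move=> _ [_ [a ->]] <-; rewrite setTI comp_preimage; apply: measurable_vector_open => //.
apply: open_comp; first by move=> x _; exact: cg.
rewrite set_itvE; exact: open_gt.
Qed.

Lemma continuous_measurable_vector U (g : 'rV[R]_d -> 'rV[R]_d) :
  measurable_vector U -> continuous g -> measurable_vector (g \o U).
Proof.
move=> mU cg i; apply: (@continuous_measurable U (fun x => g x 0 i)) => //.
by move=> x; apply: (@continuous_comp _ _ _ g (fun y : 'rV[R]_d => y 0 i)); [exact: cg|exact: coord_continuous].
Qed.

Lemma measurable_vector_cst (a : 'rV[R]_d) : measurable_vector (fun=> a).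
Proof. by move=> i; apply: (@measurable_cst _ _ T _ setT (a 0 i)). Qed.

Lemma measurable_vectorD U W : measurable_vector U -> measurable_vector W ->
  measurable_vector (fun w => U w + W w).
Proof.
move=> mU mW i; rewrite (_ : (fun _ => _) = (fun w => U w 0 i + W w 0 i)).
  exact: measurable_funD.
by rewrite funeqE => w; rewrite mxE.
Qed.

Lemma measurable_vectorZ c U : measurable_vector U ->
  measurable_vector (fun w => c *: U w).
Proof.
move=> mU i; rewrite (_ : (fun _ => _) = (fun w => c * U w 0 i)).
  by apply: measurable_funM => //; exact: (measurable_cst c).
by rewrite funeqE => w; rewrite mxE.
Qed.

Lemma measurable_vectorB U W : measurable_vector U -> measurable_vector W ->
  measurable_vector (fun w => U w - W w).
Proof.
move=> mU mW; rewrite (_ : (fun _ => _) = (fun w => U w + (-1) *: W w)).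
  by apply: measurable_vectorD => //; exact: measurable_vectorZ.
by rewrite funeqE => w; rewrite scaleN1r.
Qed.

Lemma measurable_vector_sum (J : Type) (s : seq J) (U : J -> T -> 'rV[R]_d) :
  (forall j, measurable_vector (U j)) ->
  measurable_vector (fun w => \sum_(j <- s) U j w).
Proof.
move=> mU; elim: s => [|j s ih].
  under eq_fun do rewrite big_nil; exact: measurable_vector_cst.
under eq_fun do rewrite big_cons; exact: measurable_vectorD.
Qed.

Lemma measurable_enorm U : measurable_vector U ->
  measurable_fun [set: T] (fun w => enorm (U w) ^+ 2).
Proof.
move=> mU; rewrite (_ : (fun _ => _) = (fun w => \sum_(i < d) U w 0 i * U w 0 i)).
  by apply: measurable_sum => i; exact: measurable_funM.
by rewrite funeqE => w; rewrite enorm_sqr.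
Qed.

Lemma measurable_tuple_of_vector U : measurable_vector U ->
  measurable_fun [set: T] (fun w => [tuple U w 0 i | i < d]).
Proof.
move=> mU; apply/measurable_fun_tnthP => i.
rewrite (_ : _ \o _ = fun w => U w 0 i) //.
by rewrite funeqE => w /=; rewrite tnth_mktuple.
Qed.

Lemma row_of_tupleK (u : 'rV[R]_d) : row_of_tuple [tuple u 0 i | i < d] = u.
Proof. by apply/rowP => i; rewrite mxE tnth_mktuple. Qed.

Context {dX : measure_display} {X : measurableType dX}.
Variable Q : X -> 'rV[R]_d -> 'rV[R]_d.
Hypothesis mQ : measurable_random_map Q.

Lemma measurable_random_map_comp U (V : T -> X) : measurable_vector U ->
  measurable_fun [set: T] V -> measurable_vector (fun w => Q (V w) (U w)).
Proof.
move=> mU mV i.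
rewrite (_ : (fun _ => _) = (fun q : X * d.-tuple R => Q q.1 (row_of_tuple q.2) 0 i)
   \o (fun w => (V w, [tuple U w 0 i | i < d]))).
  apply: (measurableT_comp (mQ i)); apply: measurable_fun_pair => //.
  exact: measurable_tuple_of_vector.
by rewrite funeqE => w /=; rewrite row_of_tupleK.
Qed.

End RandomVectors.

Section CompressorVariance.
Context {R : realType} {d : nat} {dX : measure_display} {X : measurableType dX}.
Variables (nu : probability X R) (Q : X -> 'rV[R]_d -> 'rV[R]_d) (omega : R).
Hypothesis cQ : unbiased_compressor nu Q omega.

(** The cross term integrates to zero because Q is unbiased. *)
Lemma compressor_perturbation (a : R) (g w : 'rV[R]_d) :
  (\int[nu]_s (enorm (a *: (Q s g - g) + w) ^+ 2)%:E <=
    (enorm w ^+ 2 + a ^+ 2 * omega * enorm g ^+ 2)%:E)%E.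
Proof.
have [mQ meanQ varQ] := cQ.
have varg : (\int[nu]_s (enorm (Q s g - g) ^+ 2)%:E <= (omega * enorm g ^+ 2)%:E)%E.
  by have := varQ g; rewrite unlock.
have mq : measurable_vector (fun s => Q s g).
  by apply: measurable_random_map_comp => //; exact: measurable_vector_cst.
have mqg : measurable_vector (fun s => Q s g - g).
  by apply: measurable_vectorB => //; exact: measurable_vector_cst.
have mE : measurable_fun setT (fun s => enorm (Q s g - g) ^+ 2) by exact: measurable_enorm.
have intE : nu.-integrable setT (fun s => (enorm (Q s g - g) ^+ 2)%:E).
  apply/integrableP; split; first exact/measurable_EFinP.
  under eq_integral do rewrite gee0_abs ?lee_fin ?sqr_ge0 //.
  exact: le_lt_trans varg (ltry _).
have int1 : nu.-integrable setT (fun=> 1%:E) by exact: finite_measure_integrable_cst.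
have intq i : nu.-integrable setT (fun s => (Q s g 0 i - g 0 i)%:E).
  apply: (@le_integrable _ _ _ nu setT _ _ (fun s => (1 + enorm (Q s g - g) ^+ 2)%:E)) => //.
  - by apply/measurable_EFinP; have := mqg i; under eq_fun do rewrite !mxE.
  - move=> s _; rewrite /= lee_fin [leRHS]ger0_norm ?addr_ge0 ?sqr_ge0 //.
    have : `|Q s g 0 i - g 0 i| <= enorm (Q s g - g).
      by have := coord_le_enorm (Q s g - g) i; rewrite !mxE.
    by move=> /le_trans; apply; have := sqr_ge0 (enorm (Q s g - g) - 1); nra.
  - by under eq_fun do rewrite EFinD; exact: integrableD.
have zq i : (\int[nu]_s (Q s g 0 i - g 0 i)%:E = 0)%E.
  have intc : nu.-integrable setT (fun=> (g 0 i)%:E) by exact: finite_measure_integrable_cst.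
  have intQ : nu.-integrable setT (fun s => (Q s g 0 i)%:E).
    rewrite (_ : (fun _ => _) = (fun s => (Q s g 0 i - g 0 i)%:E + (g 0 i)%:E)%E).
      exact: integrableD.
    by rewrite funeqE => s; rewrite -EFinD subrK.
  under eq_integral do rewrite EFinB.
  rewrite integralB //= integral_cst //= probability_setT mule1.
  by have := meanQ g i; rewrite unlock => ->; rewrite subee.
have intd : nu.-integrable setT (fun s => (dotp (Q s g - g) w)%:E) /\
    (\int[nu]_s (dotp (Q s g - g) w)%:E = 0)%E.
  have eqd : (fun s => (dotp (Q s g - g) w)%:E) =
      (fun s => \sum_(i < d) ((w 0 i)%:E * (Q s g 0 i - g 0 i)%:E))%E.
    rewrite funeqE => s; rewrite /dotp -sumEFin; apply: eq_bigr => i _.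
    by rewrite !mxE mulrC EFinM.
  have intw i : nu.-integrable setT (fun s => (w 0 i)%:E * (Q s g 0 i - g 0 i)%:E)%E.
    exact: integrableZl.
  rewrite eqd; split; first exact: integrable_sum.
  rewrite integral_sum //; apply: big1 => i _.
  by rewrite integralZl // zq mule0.
have -> : (fun s => (enorm (a *: (Q s g - g) + w) ^+ 2)%:E) =
    (fun s => ((a ^+ 2)%:E * (enorm (Q s g - g) ^+ 2)%:E +
       ((2 * a)%:E * (dotp (Q s g - g) w)%:E + (enorm w ^+ 2)%:E)))%E.
  rewrite funeqE => s; rewrite -!EFinM -!EFinD !enorm_sqr; congr (_%:E).
  move: (Q s g - g) => e; rewrite !dotpE (dotpC w e); ring.
have [intd1 intd2] := intd.
have i1 : nu.-integrable setT (fun s => (a ^+ 2)%:E * (enorm (Q s g - g) ^+ 2)%:E)%E.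
  exact: integrableZl.
have i2 : nu.-integrable setT (fun s => (2 * a)%:E * (dotp (Q s g - g) w)%:E)%E.
  exact: integrableZl.
have i3 : nu.-integrable setT (fun=> (enorm w ^+ 2)%:E).
  exact: finite_measure_integrable_cst.
rewrite integralD //; last exact: integrableD.
rewrite integralD // !integralZl // intd2 mule0 add0e integral_cst //=.
rewrite probability_setT mule1 addeC EFinD leeD2l // -mulrA (EFinM (a ^+ 2)).
by apply: lee_wpmul2l => //; rewrite lee_fin sqr_ge0.
Qed.

End CompressorVariance.

(** * Independent sources of randomness *)

Section IndependentSources.
Context {R : realType} {dO : measure_display} {Omega : measurableType dO}.
Variable P : probability Omega R.
Context {I : choiceType}.
Variable S : I -> set (set Omega).
Hypothesis S_measurable : forall i, S i `<=` measurable.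
Hypothesis S_setT : forall i, S i setT.
Hypothesis S_setI : forall i, setI_closed (S i).
Hypothesis indep : independent_systems P S.

(** The events of the sources in J; the generated sigma-algebra is the
    information carried by these sources, and replaces conditioning on them. *)
Definition known (J : set I) : set (set Omega) := \bigcup_(i in J) S i.

Local Notation sigma J := (g_sigma_algebraType (known J)).

Lemma known_sub J K : J `<=` K -> <<s known J >> `<=` <<s known K >>.
Proof.
move=> JK; apply: smallest_sub; first exact: smallest_sigma_algebra.
by move=> A [i Ji SA]; apply: sub_sigma_algebra; exists i => //; exact: JK.
Qed.

Lemma known_measurable J : <<s known J >> `<=` measurable.
Proof.
apply: smallest_sub; first exact: sigma_algebra_measurable.
by move=> A [i _]; exact: S_measurable.
Qed.

Let cylinders J : set (set Omega) := [set B | exists s (A : I -> set Omega),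
  [/\ uniq s, forall i, i \in s -> J i, forall i, S i (A i)
    & B = \bigcap_(i in [set` s]) A i]].

Let cylindersI J : setI_closed (cylinders J).
Proof.
move=> _ _ [s [A [us sJ SA ->]]] [t [B [ut tJ SB ->]]].
exists (undup (s ++ t)).
exists (fun i => (if i \in s then A i else setT) `&` (if i \in t then B i else setT)).
split.
- exact: undup_uniq.
- by move=> i; rewrite mem_undup mem_cat => /orP[/sJ|/tJ].
- by move=> i; apply: S_setI; case: ifP => _.
- rewrite eqEsubset; split => w.
    by move=> [wA wB] i /= _; split; case: ifP => // h; [exact: wA|exact: wB].
  move=> w_ ; split => i /= h; have := w_ i; rewrite /= mem_undup mem_cat h ?orbT.
    by move=> /(_ isT)[].
  by move=> /(_ isT)[].
Qed.

Let cylinders_gen J : <<s known J >> `<=` <<s cylinders J >>.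
Proof.
apply: smallest_sub; first exact: smallest_sigma_algebra.
move=> B [i Ji SB]; apply: sub_sigma_algebra.
exists [:: i], (fun j => if j == i then B else setT); split => //.
- by move=> j; rewrite inE => /eqP ->.
- by move=> j; case: eqP => [->|_].
- rewrite eqEsubset; split => w.
    by move=> wB j /=; rewrite inE => /eqP ->; rewrite eqxx.
  by move=> /(_ i) /=; rewrite inE eqxx; exact.
Qed.

Let prob_cylinder s (A : I -> set Omega) : uniq s -> (forall i, i \in s -> S i (A i)) ->
  P (\bigcap_(i in [set` s]) A i) = (\prod_(i <- s) P (A i))%E.
Proof. by move=> us SA; rewrite bigcap_seq; apply: indep. Qed.

(** The product rule extends from finite intersections to the generated
    sigma-algebra by uniqueness of measures that agree on a pi-system. *)
Lemma independent_known J i0 A B : ~ J i0 -> <<s known J >> A -> S i0 B ->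
  P (A `&` B) = (P B * P A)%E.
Proof.
move=> Ji0 sA SB; have mB := S_measurable SB.
have PBf : (0 <= fine (P B))%R by rewrite fine_ge0.
pose m1 : {measure set Omega -> \bar R} := mrestr P mB.
pose m2 : {measure set Omega -> \bar R} := mscale (NngNum PBf) P.
have m2E C : m2 C = (P B * P C)%E by rewrite -[P B in RHS]fineK ?fin_num_measure.
suff : m1 A = m2 A by rewrite m2E.
apply: (@g_sigma_algebra_measure_unique _ _ _ (cylinders J) _ (fun=> setT)) => //.
- move=> _ [s [C [us sJ SC ->]]]; rewrite bigcap_seq.
  by apply: bigsetI_measurable => i _; exact: S_measurable.
- move=> _; exists [::], (fun=> setT); split => //.
  by rewrite eqEsubset; split => w //.
- by rewrite bigcup_const //; exists 0%N.
- move=> _ [s [C [us sJ SC ->]]].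
  rewrite m2E; change (P (\bigcap_(i in [set` s]) C i `&` B) = P B * P (\bigcap_(i in [set` s]) C i))%E.
  have i0s : i0 \notin s by apply/negP => /sJ.
  pose D i := if i == i0 then B else C i.
  have -> : \bigcap_(i in [set` s]) C i `&` B = \bigcap_(i in [set` (i0 :: s)]) D i.
    rewrite eqEsubset; split => w.
      move=> [wC wB] i /=; rewrite inE /D; case: eqP => // _ /= h; exact: wC.
    move=> wD; split.
      move=> i /= h; have := wD i; rewrite /= inE h orbT /D => /(_ isT).
      by case: eqP => // e; rewrite -e h in i0s.
    by have := wD i0; rewrite /= inE eqxx /D eqxx => /(_ isT).
  have us0 : uniq (i0 :: s) by rewrite /= i0s.
  have SD i : i \in i0 :: s -> S i (D i) by move=> _; rewrite /D; case: eqP => // ->.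
  rewrite (prob_cylinder us0 SD) (prob_cylinder us) //.
  rewrite big_cons {1}/D eqxx; congr (_ * _)%E.
  apply: eq_big_seq => i h; rewrite /D; case: eqP => // e.
  by rewrite -e h in i0s.
- move=> _; change (P (setT `&` B) < +oo)%E.
  by rewrite setTI (le_lt_trans (probability_le1 _ _)) ?ltry.
- exact: cylinders_gen.
Qed.

Section FreshSource.
Context {dX : measure_display} {X : measurableType dX} (nu : probability X R).
Variables (V : Omega -> X) (J : set I) (i0 : I).
Hypotheses (mV : measurable_fun setT V) (fresh : ~ J i0).
Hypothesis SV : preimage_set_system setT V measurable `<=` S i0.
Hypothesis lawV : forall B, measurable B -> P (V @^-1` B) = nu B.

Lemma measurable_forget : measurable_fun setT (id : Omega -> sigma J).
Proof. by move=> _ A mA; rewrite setTI; exact: (known_measurable mA). Qed.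

Let Past : measurableType (known J).-sigma := sigma J.

(** By independence the joint law of the past and of a fresh source is a product
    measure, so Tonelli's theorem integrates the fresh source out first. *)
Lemma fresh_source (h : Past * X -> \bar R) : measurable_fun setT h ->
  (forall z, 0 <= h z)%E ->
  (\int[P]_w h (w, V w) = \int[P]_w \int[nu]_s h (w, s))%E.
Proof.
move=> mh h0.
pose idJ : {mfun Omega >-> Past} :=
  HB.pack (id : Omega -> Past) (isMeasurableFun.Build _ _ _ _ _ measurable_forget).
have mpair : measurable_fun setT (fun w : Omega => ((w : Past), V w)).
  by apply: measurable_fun_pair => //; exact: measurable_forget.
pose pr : {mfun Omega >-> (Past * X)%type} :=
  HB.pack (fun w : Omega => ((w : Past), V w))
    (isMeasurableFun.Build _ _ _ _ _ mpair).
pose PJ : probability (Past) R := distribution P idJ.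
have joint A : measurable A -> (PJ \x nu)%E A = distribution P pr A.
  apply: product_measure_unique => B C mB mC.
  change (P (B `&` V @^-1` C) = P B * nu C)%E.
  rewrite (independent_known fresh mB); last by apply: SV; exists C; rewrite // setTI.
  by rewrite lawV // muleC.
transitivity (\int[distribution P pr]_z h z)%E.
  by rewrite ge0_integral_pushforward.
transitivity (\int[(PJ \x nu)%E]_z h z)%E.
  by apply: eq_measure_integral => A mA _; apply: esym; exact: joint.
rewrite fubini_tonelli1 // ge0_integral_pushforward //.
- exact: measurable_fun_fubini_tonelli_F.
- by move=> w _; apply: integral_ge0.
Qed.

End FreshSource.

End IndependentSources.

(** * Accumulated compression errors *)

Section KnownFunctions.
Context {R : realType} {dO : measure_display} {Omega : measurableType dO}.
Variable P : probability Omega R.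
Context {I : choiceType}.
Variable S : I -> set (set Omega).
Hypothesis S_measurable : forall i, S i `<=` measurable.

Definition known_fun {dT} {T : measurableType dT} (J : set I) (h : Omega -> T) :=
  measurable_fun [set: g_sigma_algebraType (known S J)] h.

Definition known_vector {d} (J : set I) (U : Omega -> 'rV[R]_d) :=
  @measurable_vector R d _ (g_sigma_algebraType (known S J)) U.

Lemma known_fun_sub {dT} {T : measurableType dT} (J K : set I) (h : Omega -> T) :
  J `<=` K -> known_fun J h -> known_fun K h.
Proof. by move=> JK mh _ B mB; apply: (known_sub JK); exact: mh. Qed.

Lemma known_vector_sub {d} (J K : set I) (U : Omega -> 'rV[R]_d) :
  J `<=` K -> known_vector J U -> known_vector K U.
Proof. by move=> JK mU i; apply: known_fun_sub JK _; exact: mU. Qed.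

Lemma known_fun_measurable {dT} {T : measurableType dT} (J : set I) (h : Omega -> T) :
  known_fun J h -> measurable_fun [set: Omega] h.
Proof. by move=> mh _ B mB; apply: (known_measurable S_measurable); exact: mh. Qed.

Lemma known_vector_measurable {d} (J : set I) (U : Omega -> 'rV[R]_d) :
  known_vector J U -> measurable_vector U.
Proof. by move=> mU i; exact: known_fun_measurable (mU i). Qed.

Lemma known_source {dT} {T : measurableType dT} (J : set I) i (h : Omega -> T) :
  J i -> preimage_set_system setT h measurable `<=` S i -> known_fun J h.
Proof.
move=> Ji hS _ B mB; apply: sub_sigma_algebra; exists i => //.
by apply: hS; exists B.
Qed.

Lemma known_sqr {d} (J : set I) (U : Omega -> 'rV[R]_d) : known_vector J U ->
  measurable_fun [set: Omega] (fun w => (enorm (U w) ^+ 2)%:E).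
Proof.
move=> kU; apply/measurable_EFinP; apply: measurable_enorm.
exact: known_vector_measurable kU.
Qed.

Hypothesis S_setT : forall i, S i setT.
Hypothesis S_setI : forall i, setI_closed (S i).
Hypothesis indep : independent_systems P S.

Section Noise.
Context {d : nat} {dX : measure_display} {X : measurableType dX}.
Variables (nu : probability X R) (Q : X -> 'rV[R]_d -> 'rV[R]_d) (omega : R).
Hypothesis omega_ge0 : 0 <= omega.
Hypothesis cQ : unbiased_compressor nu Q omega.

Lemma known_random_map (J : set I) i (V : Omega -> X) (U : Omega -> 'rV[R]_d) :
  J i -> preimage_set_system setT V measurable `<=` S i ->
  known_vector J U -> known_vector J (fun w => Q (V w) (U w)).
Proof.
move=> Ji SV kU; have [mQ _ _] := cQ.
apply: measurable_random_map_comp => //.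
exact: (known_source Ji SV).
Qed.

Lemma expected_sqr_one_source (J : set I) i0 (V : Omega -> X) (a : R) (g W : Omega -> 'rV[R]_d) :
  ~ J i0 -> measurable_fun setT V ->
  preimage_set_system setT V measurable `<=` S i0 ->
  (forall B, measurable B -> P (V @^-1` B) = nu B) ->
  known_vector J g -> known_vector J W ->
  (\int[P]_w (enorm (a *: (Q (V w) (g w) - g w) + W w) ^+ 2)%:E <=
   \int[P]_w (enorm (W w) ^+ 2)%:E +
   (a ^+ 2 * omega)%:E * \int[P]_w (enorm (g w) ^+ 2)%:E)%E.
Proof.
move=> Ji0 mV SV lawV kg kW; have [mQ _ _] := cQ.
pose h (z : g_sigma_algebraType (known S J) * X) : \bar R :=
  (enorm (a *: (Q z.2 (g z.1) - g z.1) + W z.1) ^+ 2)%:E.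
have k1 (U : Omega -> 'rV[R]_d) : known_vector J U ->
    @measurable_vector R d _ (g_sigma_algebraType (known S J) * X)%type (fun z => U z.1).
  by move=> kU i; apply: (measurableT_comp (kU i)); exact: measurable_fst.
have mh : measurable_fun setT h.
  apply/measurable_EFinP; apply: measurable_enorm.
  apply: measurable_vectorD; last exact: k1.
  apply: measurable_vectorZ; apply: measurable_vectorB; last exact: k1.
  by apply: measurable_random_map_comp => //; exact: k1.
rewrite (fresh_source S_measurable S_setT S_setI indep mV Ji0 SV lawV mh); last first.
  by move=> z; rewrite lee_fin sqr_ge0.
have mW := known_sqr kW; have mg := known_sqr kg.
have c0 : 0 <= a ^+ 2 * omega by rewrite mulr_ge0 // sqr_ge0.
rewrite -ge0_integralZl //; last by move=> w _; rewrite lee_fin sqr_ge0.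
rewrite -ge0_integralD //; first last.
- by apply: measurable_funeM.
- by move=> w _; rewrite mule_ge0 ?lee_fin // sqr_ge0.
- by move=> w _; rewrite lee_fin sqr_ge0.
apply: ge0_le_integral => //.
- by move=> w _; apply: integral_ge0 => s _; rewrite lee_fin sqr_ge0.
- apply: (known_fun_measurable (J := J)).
  apply: (@measurable_fun_fubini_tonelli_F _ _ _ _ _ nu h) => //.
  by move=> z; rewrite lee_fin sqr_ge0.
- by apply: emeasurable_funD => //; apply: measurable_funeM.
- by move=> w _; apply: le_trans (compressor_perturbation cQ a (g w) (W w)) _.
Qed.

(** Adding the errors one source at a time: each new source is independent of
    the sum so far, so no cross term is ever expanded. *)
Lemma expected_sqr_sum_sources (A : eqType) (src : A -> I) (V : A -> Omega -> X) (s : seq A) (a : R)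
    (g : A -> Omega -> 'rV[R]_d) (J : set I) (W : Omega -> 'rV[R]_d) :
  injective src -> (forall m, measurable_fun setT (V m)) ->
  (forall m, preimage_set_system setT (V m) measurable `<=` S (src m)) ->
  (forall m B, measurable B -> P (V m @^-1` B) = nu B) ->
  uniq s -> (forall m, m \in s -> ~ J (src m)) ->
  (forall m, known_vector J (g m)) -> known_vector J W ->
  (\int[P]_w (enorm (\sum_(m <- s) a *: (Q (V m w) (g m w) - g m w) + W w) ^+ 2)%:E <=
   \int[P]_w (enorm (W w) ^+ 2)%:E +
   \sum_(m <- s) (a ^+ 2 * omega)%:E * \int[P]_w (enorm (g m w) ^+ 2)%:E)%E.
Proof.
move=> isrc mV SV lawV; elim: s J W => [|m s ih] J W /=.
  by move=> _ _ _ _; rewrite big_nil adde0; under eq_integral do rewrite big_nil add0r.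
move=> /andP[ms us] fresh kg kW.
pose J' := J `|` [set src m].
pose W' w := a *: (Q (V m w) (g m w) - g m w) + W w.
have kg' m' : known_vector J' (g m') by apply: known_vector_sub (kg m'); left.
have kW' : known_vector J' W'.
  apply: measurable_vectorD; last by apply: known_vector_sub kW; left.
  apply: measurable_vectorZ; apply: measurable_vectorB; last exact: kg'.
  by apply: (@known_random_map J' (src m)) => //; right.
have fresh' m' : m' \in s -> ~ J' (src m').
  move=> m's [|/isrc e]; first by apply: fresh; rewrite inE m's orbT.
  by rewrite -e m's in ms.
have := ih J' W' us fresh' kg' kW'; rewrite /W'.
under eq_integral do rewrite addrA.
rewrite big_cons addeA => h.
under eq_integral do rewrite big_cons (addrC (a *: _)).
apply: le_trans h _; apply: leeD => //.
have fm : ~ J (src m) by apply: fresh; rewrite inE eqxx.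
exact: (expected_sqr_one_source a fm (mV m) (SV m) (lawV m) (kg m) kW).
Qed.

End Noise.

Section Mixture.
Variables (Nf : Omega -> nat) (i0 : I) (J : set I) (F : nat -> Omega -> \bar R).
Hypotheses (mN : measurable_fun setT Nf) (fresh : ~ J i0).
Hypothesis SN : preimage_set_system setT Nf measurable `<=` S i0.
Hypothesis kF : forall n, known_fun J (F n).
Hypothesis F_ge0 : forall n w, (0 <= F n w)%E.

(** Decompose over the values of the time: each event depends on the fresh source
    alone, hence is independent of the process. *)
Lemma expectation_at_time :
  (\int[P]_w F (Nf w) w = \sum_(n <oo) P (Nf @^-1` [set n]) * \int[P]_w F n w)%E.
Proof.
have mF n := known_fun_measurable (kF n).
have m1 n : measurable_fun setT (fun w => (\1_[set n] (Nf w) : R)%:E).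
  apply/measurable_EFinP.
  by apply: (@measurableT_comp _ _ _ _ _ _ (\1_[set n] : nat -> R)).
have split_time w : F (Nf w) w = (\sum_(n <oo) (\1_[set n] (Nf w))%:E * F n w)%E.
  rewrite (@nneseriesD1 _ _ (Nf w)) //.
    rewrite indicE mem_set //= mul1e eseries0 ?adde0 // => n _ /= nN.
    by rewrite indicE memNset ?mul0e //= => e; rewrite e eqxx in nN.
  by move=> n _; rewrite mule_ge0.
under eq_integral do rewrite split_time.
rewrite integral_nneseries //; first last.
- by move=> n w _; rewrite mule_ge0 // lee_fin.
- by move=> n; exact: emeasurable_funM.
apply: eq_eseriesr => n _.
pose Npack : {mfun Omega >-> nat} := HB.pack Nf (isMeasurableFun.Build _ _ _ _ _ mN).
pose h (z : g_sigma_algebraType (known S J) * nat) : \bar R :=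
  ((\1_[set n] z.2 : R)%:E * F n z.1)%E.
have mh : measurable_fun setT h.
  apply: emeasurable_funM.
    apply/measurable_EFinP.
    by apply: (@measurableT_comp _ _ _ _ _ _ (\1_[set n] : nat -> R)) => //; exact: measurable_snd.
  by apply: (measurableT_comp (kF n)); exact: measurable_fst.
rewrite (@fresh_source _ _ _ _ _ _ S_measurable S_setT S_setI indep _ _
   (distribution P Npack) _ _ _ mN fresh SN _ h) //; last first.
  by move=> z; rewrite mule_ge0 // lee_fin.
have mI : measurable_fun setT (fun i : nat => (\1_[set n] i : R)%:E).
  exact/measurable_EFinP.
under eq_integral => w _.
  rewrite /h /= ge0_integralZr //.
  rewrite integral_indic // setIT /=.
  over.
by rewrite ge0_integralZl.
Qed.

End Mixture.

End KnownFunctions.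

(** * Geometric epoch lengths *)

Section GeometricSums.
Context {R : realType}.
Implicit Types (p q H c kappa : R) (a r psi h : nat -> R).

(** For a geometric length N, the mean of a (N - 1) is p (a 0) + q E (a N): the
    one-step decrease of a, averaged over N, becomes p (a 0 - a N). The same
    identity bounds the mean of r (N - 1) by that of r N, as r 0 = 0, so the
    errors kappa r of the steps are paid by the kappa' r of the end of the epoch.
    The sums are truncated at n, and the correction p (a 0) q^n accounts for the
    missing tail. *)
Lemma weighted_descent p q H c kappa (kappa' : R) a r psi h :
  p = 1 - q -> 0 <= q <= 1 -> 0 <= H + c -> 0 <= kappa <= kappa' ->
  (forall j, 0 <= a j) -> (forall j, 0 <= r j) -> r 0%N = 0 ->
  (forall j, h j.+1 + a j.+1 <= H + a j + kappa * r j) ->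
  (forall j, psi j.+1 + p * a 0%N + kappa' * r j.+1 <= h j.+1 + p * a j.+1 + c) ->
  forall n, \sum_(i < n) p * q ^+ i * psi i.+1 <= H + c + p * a 0%N * q ^+ n.
Proof.
move=> pE /andP[q0 q1] Hc /andP[k0 kk'] a0 r0 r00 step pot n.
have p0 : 0 <= p by rewrite pE subr_ge0.
(* The stronger bound keeps what the truncation at n leaves of a and r. *)
suff inv : \sum_(i < n) p * q ^+ i * psi i.+1 <=
    (1 - q ^+ n) * (H + c) + p * q ^+ n * (a 0%N - a n - kappa * r n).
  apply: le_trans inv _; have qn0 : 0 <= q ^+ n by exact: exprn_ge0.
  have h1 : 0 <= q ^+ n * (H + c) by exact: mulr_ge0.
  have h2 : 0 <= p * q ^+ n * (a n + kappa * r n).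
    by rewrite mulr_ge0 ?mulr_ge0 // addr_ge0 // mulr_ge0.
  move: h1 h2; rewrite mulrBl mul1r !mulrBr mulrDr; lra.
elim: n => [|n ih].
  by rewrite big_ord0 expr0 r00 !subrr !mul0r mulr0 subr0 mulr0 addr0.
rewrite big_ord_recr /= exprS.
have qn0 : 0 <= q ^+ n by exact: exprn_ge0.
have w0 : 0 <= p * q ^+ n by exact: mulr_ge0.
have main : psi n.+1 <= H + c + (a n - q * a n.+1) - p * a 0%N
    + kappa * r n - q * kappa * r n.+1.
  have := step n; have := pot n.
  have : kappa * r n.+1 <= kappa' * r n.+1 by exact: ler_wpM2r.
  have : q * (kappa * r n.+1) <= kappa * r n.+1.
    by rewrite ler_piMl // mulr_ge0.
  have -> : q * a n.+1 = a n.+1 - p * a n.+1 by rewrite pE; ring.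
  rewrite mulrA; lra.
have := ler_wpM2l w0 main; move: ih.
move: (\sum_(i < n) _) (q ^+ n) (psi n.+1) => Sn Q x.
have -> : p * Q * (H + c + (a n - q * a n.+1) - p * a 0%N + kappa * r n
    - q * kappa * r n.+1) =
  (1 - q * Q) * (H + c) + p * (q * Q) * (a 0%N - a n.+1 - kappa * r n.+1)
  - ((1 - Q) * (H + c) + p * Q * (a 0%N - a n - kappa * r n)).
  by rewrite pE; ring.
lra.
Qed.

Lemma geometric_mean_le p n : 0 < p <= 1 ->
  \sum_(i < n) p * (1 - p) ^+ i * i.+1%:R <= p^-1.
Proof.
move=> /andP[p0 p1].
have -> : \sum_(i < n) p * (1 - p) ^+ i * i.+1%:R =
    p^-1 - (1 - p) ^+ n * (n%:R + p^-1).
  elim: n => [|n ih]; first by rewrite big_ord0 expr0 add0r mul1r subrr.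
  rewrite big_ord_recr /= ih exprS -(natr1 n); field; rewrite gt_eqF //.
rewrite lerBlDr lerDl mulr_ge0 ?exprn_ge0 ?subr_ge0 // addr_ge0 // invr_ge0 ltW //.
Qed.

Lemma geometric_total p n : \sum_(i < n) p * (1 - p) ^+ i = 1 - (1 - p) ^+ n.
Proof.
elim: n => [|n ih]; first by rewrite big_ord0 expr0 subrr.
by rewrite big_ord_recr /= ih exprS; ring.
Qed.

Lemma geometric_vanish (x q b c : R) : 0 <= q < 1 ->
  (forall n, x <= b + c * q ^+ n) -> x <= b.
Proof.
move=> /andP[q0 q1] h.
have cv : (b + c * q ^+ n) @[n --> \oo] --> b + c * 0.
  apply: cvgD; first exact: cvg_cst.
  apply: cvgMl_tmp; apply: cvg_expr; rewrite ger0_norm //.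
have := cvgr_to_ge cv; rewrite mulr0 addr0; apply.
by apply: nearW => n; exact: h.
Qed.

End GeometricSums.

Section GeometricTime.
Context {R : realType} {dO : measure_display} {Omega : measurableType dO}.
Variable P : probability Omega R.
Context {I : choiceType}.
Variable S : I -> set (set Omega).
Hypothesis S_measurable : forall i, S i `<=` measurable.
Hypothesis S_setT : forall i, S i setT.
Hypothesis S_setI : forall i, setI_closed (S i).
Hypothesis indep : independent_systems P S.
Variables (Nf : Omega -> nat) (i0 : I) (J : set I) (F : nat -> Omega -> \bar R) (p : R).
Hypotheses (mN : measurable_fun setT Nf) (fresh : ~ J i0).
Hypothesis SN : preimage_set_system setT Nf measurable `<=` S i0.
Hypothesis kF : forall n, known_fun S J (F n).
Hypothesis F_ge0 : forall n w, (0 <= F n w)%E.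
Hypothesis p01 : 0 < p <= 1.
Hypothesis lawN : geometric_law P p Nf.

(** The probabilities of the positive integers already add up to 1. *)
Lemma geometric_law0 : P (Nf @^-1` [set 0%N]) = 0%E.
Proof.
have [p0 p1] := andP p01.
have mA n : measurable (Nf @^-1` [set n]).
  by rewrite -[X in measurable X]setTI; exact: mN.
have fA : P (Nf @^-1` [set 0%N]) \is a fin_num by rewrite fin_num_measure.
apply/eqP; rewrite eq_le measure_ge0 andbT -(fineK fA) lee_fin.
apply: (@geometric_vanish _ _ (1 - p) 0 1) => [|n].
  by rewrite subr_ge0 p1 /= ltrBlDr ltrDl.
rewrite add0r mul1r -lee_fin fineK //.
have tot : (\sum_(i < n.+1) P (Nf @^-1` [set (i : nat)]) <= 1)%E.
  rewrite -(@measure_bigsetU _ _ _ P (fun i => Nf @^-1` [set i])) //; last first.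
    by apply/trivIsetP => i j _ _ /eqP ij; rewrite eqEsubset; split => w //= [-> /ij].
  by apply: probability_le1; apply: bigsetU_measurable => i _; exact: mA.
move: tot; rewrite big_ord_recl /=.
under eq_bigr => i _ do rewrite (lawN (ltn0Sn _)) /=.
rewrite sumEFin geometric_total -{1}(fineK fA) -EFinD lee_fin => h.
by rewrite -(fineK fA) lee_fin; lra.
Qed.

Lemma geometric_expectation_le (psi : nat -> R) (B C : R) :
  (forall n, \int[P]_w F n.+1 w = (psi n.+1)%:E)%E ->
  (forall n, \sum_(i < n) p * (1 - p) ^+ i * psi i.+1 <= B + C * (1 - p) ^+ n) ->
  (\int[P]_w F (Nf w) w <= B%:E)%E.
Proof.
move=> Fpsi bound; have [p0 p1] := andP p01.
rewrite (@expectation_at_time _ _ _ P _ S S_measurable S_setT S_setI indep Nf i0 J) //.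
have t0 n : (0 <= P (Nf @^-1` [set n]) * \int[P]_w F n w)%E.
  by rewrite mule_ge0 // integral_ge0.
apply/lee_addgt0Pr => e e0.
apply: lime_le; first exact: is_cvg_nneseries.
have q01 : `|1 - p| < 1 by rewrite ger0_norm ?subr_ge0 // ltrBlDr ltrDl.
have : \forall n \near \oo, C * (1 - p) ^+ n <= e.
  have cv : (C * (1 - p) ^+ n) @[n --> \oo] --> C * 0.
    by apply: cvgMl_tmp; exact: cvg_expr.
  by rewrite mulr0 in cv; exact: cvgr_le cv _ e0.
move=> near_e; apply: near_inftyS; near=> n.
rewrite /= big_mkord big_ord_recl /= geometric_law0 mul0e add0e.
have -> : (\sum_(i < n) P (Nf @^-1` [set (bump 0 i)]) *
    \int[P]_w F (bump 0 i) w = \sum_(i < n) (p * (1 - p) ^+ i * psi i.+1)%:E)%E.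
  apply: eq_bigr => i _; rewrite /bump /= add1n (lawN (ltn0Sn _)) /= Fpsi.
  by rewrite -EFinM.
rewrite sumEFin -EFinD lee_fin; apply: le_trans (bound n) _.
rewrite lerD2l; near: n; exact: near_e.
Unshelve. all: by end_near.
Qed.

End GeometricTime.

(** * Expectations *)

Section Expectation.
Context {R : realType} {dO : measure_display} {Omega : measurableType dO}.
Variable P : probability Omega R.
Implicit Types (g h : Omega -> R).

(** An extended real, so that the expectation of a nonnegative function always makes
    sense. *)
Definition Ex h := (\int[P]_w (h w)%:E)%E.

Arguments Ex h%_R.

Lemma Ex_ge0 h : (forall w, 0 <= h w) -> (0 <= Ex h)%E.
Proof. by move=> h0; apply: integral_ge0 => w _; rewrite lee_fin. Qed.

Lemma ExD g h : measurable_fun setT g -> measurable_fun setT h ->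
  (forall w, 0 <= g w) -> (forall w, 0 <= h w) ->
  Ex (fun w => g w + h w) = (Ex g + Ex h)%E.
Proof.
move=> mg mh g0 h0; rewrite /Ex; under eq_integral do rewrite EFinD.
have mg' : measurable_fun setT (fun w => (g w)%:E) by exact/measurable_EFinP.
have mh' : measurable_fun setT (fun w => (h w)%:E) by exact/measurable_EFinP.
by rewrite ge0_integralD // => w _; rewrite lee_fin.
Qed.

Lemma ExZ c h : measurable_fun setT h -> 0 <= c -> (forall w, 0 <= h w) ->
  Ex (fun w => c * h w) = (c%:E * Ex h)%E.
Proof.
move=> mh c0 h0; rewrite /Ex; under eq_integral do rewrite EFinM.
have mh' : measurable_fun setT (fun w => (h w)%:E) by exact/measurable_EFinP.
by rewrite ge0_integralZl // => w _; rewrite lee_fin.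
Qed.

Lemma Ex_le g h : measurable_fun setT g -> measurable_fun setT h ->
  (forall w, 0 <= g w <= h w) -> (Ex g <= Ex h)%E.
Proof.
move=> mg mh gh; apply: ge0_le_integral => //; try exact/measurable_EFinP.
- by move=> w _; rewrite lee_fin; case/andP: (gh w).
- by move=> w _; rewrite lee_fin; case/andP: (gh w).
Qed.

Context {d : nat}.
Implicit Types (U W : Omega -> 'rV[R]_d).

Definition square_integrable U :=
  measurable_vector U /\ (Ex (fun w => enorm (U w) ^+ 2)%R < +oo)%E.

Lemma square_integrable_cst (a : 'rV[R]_d) : square_integrable (fun=> a).
Proof.
split; first exact: measurable_vector_cst.
by rewrite /Ex integral_cst //= probability_setT mule1 ltry.
Qed.

Lemma square_integrableZ c U : square_integrable U ->
  square_integrable (fun w => c *: U w).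
Proof.
move=> [mU fU]; split; first exact: measurable_vectorZ.
have -> : (fun w => enorm (c *: U w) ^+ 2) = (fun w => c ^+ 2 * enorm (U w) ^+ 2).
  by rewrite funeqE => w; rewrite enormZ exprMn real_normK ?num_real.
rewrite ExZ ?sqr_ge0 //; last 2 first.
- exact: measurable_enorm.
- by move=> w; exact: sqr_ge0.
by rewrite lte_mul_pinfty // ?lee_fin ?sqr_ge0.
Qed.

Lemma square_integrableD U W : square_integrable U -> square_integrable W ->
  square_integrable (fun w => U w + W w).
Proof.
move=> [mU fU] [mW fW]; split; first exact: measurable_vectorD.
have mU2 := measurable_enorm mU; have mW2 := measurable_enorm mW.
apply: (@le_lt_trans _ _ (Ex (fun w => 2 * (enorm (U w) ^+ 2 + enorm (W w) ^+ 2)))).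
  apply: Ex_le.
  - by apply: measurable_enorm; exact: measurable_vectorD.
  - by apply: measurable_funM => //; exact: measurable_funD.
  - move=> w; rewrite sqr_ge0 /=; have := dotp_ge0 (U w - W w).
    rewrite !enorm_sqr !dotpE (dotpC (W w)); lra.
rewrite ExZ //; last 2 first.
- exact: measurable_funD.
- by move=> w; rewrite addr_ge0 ?sqr_ge0.
rewrite ExD // => [|w|w]; rewrite ?sqr_ge0 //.
by rewrite lte_mul_pinfty // lte_add_pinfty.
Qed.

Lemma square_integrableB U W : square_integrable U -> square_integrable W ->
  square_integrable (fun w => U w - W w).
Proof.
move=> sU sW; have := square_integrableD sU (square_integrableZ (-1) sW).
by under eq_fun do rewrite scaleN1r.
Qed.

Lemma measurable_dotp U W : measurable_vector U -> measurable_vector W ->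
  measurable_fun setT (fun w => dotp (U w) (W w)).
Proof.
move=> mU mW; rewrite /dotp; apply: measurable_sum => i; exact: measurable_funM.
Qed.

Lemma measurable_at_time (dT : measure_display) (T : measurableType dT)
    (n : T -> nat) (V : nat -> T -> 'rV[R]_d) :
  measurable_fun setT n -> (forall i, measurable_vector (V i)) ->
  measurable_vector (fun w => V (n w) w).
Proof.
move=> mn mV i _ B mB; rewrite setTI.
have -> : (fun w => V (n w) w 0 i) @^-1` B =
    \bigcup_k (n @^-1` [set k] `&` (fun w => V k w 0 i) @^-1` B).
  rewrite eqEsubset; split => w; first by move=> Bw; exists (n w).
  by move=> [k _ [<-]].
apply: bigcupT_measurable => k; apply: measurableI.
  by rewrite -[X in measurable X]setTI; exact: mn.
by rewrite -[X in measurable X]setTI; exact: mV.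
Qed.

End Expectation.

Arguments Ex {R dO Omega} P h%_R.

Section Sources.
Context {dO : measure_display} {Omega : measurableType dO}.

Lemma preimage_system_setT {dT : measure_display} {T : measurableType dT}
    (V : Omega -> T) : preimage_set_system setT V measurable setT.
Proof. by exists setT => //; rewrite setIT. Qed.

Lemma preimage_system_setI {dT : measure_display} {T : measurableType dT}
    (V : Omega -> T) : setI_closed (preimage_set_system setT V measurable).
Proof.
move=> _ _ [A mA <-] [B mB <-]; exists (A `&` B); first exact: measurableI.
by rewrite !setTI.
Qed.

Lemma preimage_system_measurable {dT : measure_display} {T : measurableType dT}
    (V : Omega -> T) : measurable_fun setT V ->
  preimage_set_system setT V measurable `<=` measurable.
Proof. by move=> mV _ [A mA <-]; exact: mV. Qed.

End Sources.

(** * The expected potential *)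

(** The distance v to the mixed point occurs on both sides and cancels, which is
    legitimate in the extended reals since it is finite. *)
Lemma cancel_variance {R : realType} (theta t p : R) (L n F a v r : \bar R) :
  0 < theta -> (0 <= v)%E -> (v < +oo)%E -> (0 <= r)%E -> (r < +oo)%E ->
  (0 <= F)%E -> (F < +oo)%E -> (0 <= a)%E -> (a < +oo)%E ->
  (L + (4 * theta)^-1%:E * v <= t%:E * F + a + theta%:E * n)%E ->
  (n <= ((4 * theta ^+ 2)^-1)%:E * v + (p / (16 * theta ^+ 2))%:E * r)%E ->
  (L <= t%:E * F + a + (p / (16 * theta))%:E * r)%E.
Proof.
move=> theta_gt0; have theta_ge0 : (0 <= theta%:E)%E by rewrite lee_fin ltW.
case: v => [v| |] // _ _; case: r => [r| |] // _ _; case: F => [F| |] // _ _.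
case: a => [a| |] // _ _ step /(lee_wpmul2l theta_ge0) tn.
have := le_trans step (leeD2l _ tn).
rewrite -!EFinM -!EFinD -leeBrDr // -EFinB => /le_trans; apply.
rewrite lee_fin le_eqVlt; apply/orP; left; apply/eqP.
by field; rewrite gt_eqF.
Qed.

Lemma fin_step {R : realType} (t c A' B' F' a' r' : R) (A B F a r : \bar R) :
  (A + B <= t%:E * F + a + c%:E * r)%E -> A = A'%:E -> B = B'%:E -> F = F'%:E ->
  a = a'%:E -> r = r'%:E -> A' + B' <= t * F' + a' + c * r'.
Proof.
by move=> h eA eB eF ea er; move: h; rewrite eA eB eF ea er -!EFinM -!EFinD lee_fin.
Qed.

Lemma fin_potential {R : realType} (p c t : R) (b' r' h' a' z' : R) (x b r h a z : \bar R) :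
  (x + p%:E * b + c%:E * r <= h + p%:E * a + t%:E * z)%E -> (0 <= x)%E ->
  b = b'%:E -> r = r'%:E -> h = h'%:E -> a = a'%:E -> z = z'%:E ->
  x = (fine x)%:E /\ fine x + p * b' + c * r' <= h' + p * a' + t * z'.
Proof.
move=> le x0 eb er eh ea ez; move: le; rewrite eb er eh ea ez -!EFinM -!EFinD.
by case: x x0 => [x| |] //= _; rewrite lee_fin.
Qed.

Section StochasticOlga.
Context {R : realType} {d M : nat} {dX : measure_display} {X : measurableType dX}.
Context {dO : measure_display} {Omega : measurableType dO}.
Variables (P : probability Omega R) (nu : probability X R).
Variables (f : 'I_M -> 'rV[R]_d -> R) (server : 'I_M).
Variable Q : X -> 'rV[R]_d -> 'rV[R]_d.
Variables (N : nat -> Omega -> nat) (xi : nat -> nat -> 'I_M -> Omega -> X).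
Variables (delta mu theta omega p tau alpha : R) (xs y0 : 'rV[R]_d).
Hypothesis f_smooth : forall m, twice_differentiable (f m).
Hypothesis f_related : delta_related f delta.
Hypothesis f_convex : strongly_convex mu (favg f).
Hypotheses (delta_gt0 : 0 < delta) (mu_gt0 : 0 < mu) (theta_gt0 : 0 < theta).
Hypothesis delta_theta : delta <= (2 * theta)^-1.
Hypothesis xs_min : forall x, favg f xs <= favg f x.
Hypotheses (tau01 : 0 < tau <= 1) (p01 : 0 < p <= 1) (alpha_gt0 : 0 < alpha).
Hypothesis tau_alpha : tau * alpha = theta / (8 * p).
Hypothesis omega_ge0 : 0 <= omega.
Hypothesis cQ : unbiased_compressor nu Q omega.
Hypothesis noise_small : omega / M%:R * (4 * delta ^+ 2) <= p / (16 * theta ^+ 2).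
Hypothesis randomness : olga_randomness P nu p N xi.

Local Notation fb := (favg f).
Local Notation f1 := (f server).
Let I : choiceType := (nat + nat * nat * 'I_M)%type.
Let S : I -> set (set Omega) := source_events N xi.

Let p_gt0 : 0 < p. Proof. by case/andP: p01. Qed.
Let tau01' : 0 <= tau <= 1. Proof. by have [t0 ->] := andP tau01; rewrite ltW. Qed.

Let mN k : measurable_fun setT (N k).
Proof. by have [h _ _] := randomness; case: (h k). Qed.

Let lawN k : geometric_law P p (N k).
Proof. by have [h _ _] := randomness; case: (h k). Qed.

Let mxi k j m : measurable_fun setT (xi k j m).
Proof. by have [_ h _] := randomness; case: (h k j m). Qed.

Let lawxi k j m B : measurable B -> P (xi k j m @^-1` B) = nu B.
Proof. by have [_ h _] := randomness; case: (h k j m) => _; exact. Qed.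

Let indep : independent_systems P S.
Proof. by have [_ _] := randomness. Qed.

Let S_measurable i : S i `<=` measurable.
Proof. by case: i => [k|[[k j] m]]; exact: preimage_system_measurable. Qed.

Let S_setT i : S i setT.
Proof. by case: i => [k|[[k j] m]]; exact: preimage_system_setT. Qed.

Let S_setI i : setI_closed (S i).
Proof. by case: i => [k|[[k j] m]]; exact: preimage_system_setI. Qed.

Definition state k w := olga f server Q mu p theta tau alpha y0
  (fun i => N i w) (fun i j m => xi i j m w) k.
Definition seeds k w : nat -> 'I_M -> X := fun j m => xi k j m w.
Definition anchor k w := olga_x tau (state k w).
Definition inner k j w := epoch f server Q theta (seeds k w) (anchor k w) j.
Definition after_epoch k n w :=
  olga_step f server Q mu p theta tau alpha n (seeds k w) (state k w).

Let state_succ k w : state k.+1 w = after_epoch k (N k w) w.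
Proof. by []. Qed.

Let inner_succ k j w : inner k j.+1 w =
  epoch_step f server Q theta (seeds k w j) (anchor k w) (inner k j w).
Proof. by []. Qed.

(** The length of the epoch of iteration k belongs to neither of these sets: the
    inner points form a process that does not know when it is stopped. *)
Definition past k : set I := fun i =>
  match i with inl l => (l < k)%N | inr (l, _, _) => (l < k)%N end.
Definition past_inner k j : set I := fun i =>
  match i with
  | inl l => (l < k)%N
  | inr (l, i, _) => (l < k)%N || ((l == k) && (i < j)%N)
  end.

Let past_sub k j : past k `<=` past_inner k j.
Proof. by move=> [l|[[l i] m]] //= ->. Qed.

Let past_inner_succ k j : past_inner k j `<=` past_inner k j.+1.
Proof.
move=> [l|[[l i] m]] //= /orP[->//|/andP[/eqP -> ij]].
by rewrite eqxx ltnS (ltnW ij) orbT.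
Qed.

Let past_succ k j : past_inner k j `<=` past k.+1.
Proof.
move=> [l|[[l i] m]] /= => [lk|/orP[lk|/andP[/eqP -> _]]] //; exact: ltnW.
Qed.

Let known_grad J m (U : Omega -> 'rV[R]_d) : known_vector S J U ->
  known_vector S J (fun w => grad (f m) (U w)).
Proof.
by move=> kU; apply: (continuous_measurable_vector kU); exact: grad_continuous.
Qed.

Let known_grad_favg J (U : Omega -> 'rV[R]_d) : known_vector S J U ->
  known_vector S J (fun w => grad fb (U w)).
Proof.
by move=> kU; apply: (continuous_measurable_vector kU); exact: grad_favg_continuous.
Qed.

Let known_drift J m (U0 U : Omega -> 'rV[R]_d) : known_vector S J U0 ->
  known_vector S J U -> known_vector S J (fun w => drift f server m (U0 w) (U w)).
Proof.
move=> kU0 kU; rewrite /drift.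
apply: measurable_vectorD; last exact: known_grad.
apply: measurable_vectorB; last exact: known_grad.
by apply: measurable_vectorB; exact: known_grad.
Qed.

Let known_state_at k := known_vector S (past k) (fun w => (state k w).1) /\
  known_vector S (past k) (fun w => (state k w).2).

Let known_anchor k : known_state_at k -> known_vector S (past k) (anchor k).
Proof.
by move=> [ky kz]; apply: measurable_vectorD; exact: measurable_vectorZ.
Qed.

Let known_inner k j : known_state_at k ->
  known_vector S (past_inner k j) (inner k j).
Proof.
move=> ks; have ka i := known_vector_sub (@past_sub k i) (known_anchor ks).
elim: j => [|j ih]; first exact: ka.
have ih' := known_vector_sub (@past_inner_succ k j) ih.
rewrite (_ : inner k j.+1 = fun w => resolvent f server theta (theta^-1 *: inner k j w -
    gradient_estimate f server (fun m => Q (xi k j m w)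
      (drift f server m (anchor k w) (inner k j w))) (anchor k w))); last first.
  rewrite funeqE => w; rewrite inner_succ.
  exact: (@epoch_step_resolvent _ _ _ _ f server Q delta mu theta).
apply: continuous_measurable_vector; last first.
  exact: (@resolvent_continuous _ _ _ f server delta mu theta).
apply: measurable_vectorB; first exact: measurable_vectorZ.
apply: measurable_vectorD; last by apply: known_grad_favg; exact: ka.
apply: measurable_vectorB; last by apply: known_grad; exact: ka.
apply: measurable_vectorZ; apply: measurable_vector_sum => m.
apply: (@known_random_map _ _ _ _ S _ _ _ nu Q omega cQ (past_inner k j.+1)
  (inr (k, j, m)) (xi k j m)) => //=.
- by rewrite eqxx ltnSn orbT.
- by apply: known_drift; [exact: ka|exact: ih'].
Qed.

Let known_after_epoch k n : known_state_at k ->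
  known_vector S (past_inner k n) (fun w => (after_epoch k n w).1) /\
  known_vector S (past_inner k n) (fun w => (after_epoch k n w).2).
Proof.
move=> ks; have kin := @known_inner k n ks; have [ky kz] := ks.
have ka := known_vector_sub (@past_sub k n) (known_anchor ks).
have kz' := known_vector_sub (@past_sub k n) kz.
split; first exact: kin.
rewrite (_ : (fun w => _) = fun w => (alpha^-1 + mu)^-1 *: (alpha^-1 *: (state k w).2
    + mu *: inner k n w - p *: (gphi (grad fb) (grad f1) (anchor k w)
      - gphi (grad fb) (grad f1) (inner k n w) + theta^-1 *: (anchor k w - inner k n w)))).
  have kphi U : known_vector S (past_inner k n) U ->
      known_vector S (past_inner k n) (fun w => gphi (grad fb) (grad f1) (U w)).
    move=> kU; apply: measurable_vectorB; first exact: known_grad.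
    exact: known_grad_favg.
  apply: measurable_vectorZ; apply: measurable_vectorB.
    by apply: measurable_vectorD; apply: measurable_vectorZ.
  apply: measurable_vectorZ; apply: measurable_vectorD.
    by apply: measurable_vectorB; exact: kphi.
  by apply: measurable_vectorZ; exact: measurable_vectorB.
rewrite funeqE => w; exact: olga_step_z.
Qed.

Let known_state k : known_state_at k.
Proof.
elim: k => [|k ks]; first by split; exact: measurable_vector_cst.
have kN : known_fun S (past k.+1) (N k).
  by apply: (@known_source _ _ _ S _ _ _ (inl k)) => //=.
have kat n := @known_after_epoch k n ks.
have k1 n : known_vector S (past k.+1) (fun w => (after_epoch k n w).1).
  exact: known_vector_sub (@past_succ k n) (kat n).1.
have k2 n : known_vector S (past k.+1) (fun w => (after_epoch k n w).2).
  exact: known_vector_sub (@past_succ k n) (kat n).2.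
have H1 := measurable_at_time (T := g_sigma_algebraType (known S (past k.+1)))
  (V := fun n w => (after_epoch k n w).1) kN k1.
have H2 := measurable_at_time (T := g_sigma_algebraType (known S (past k.+1)))
  (V := fun n w => (after_epoch k n w).2) kN k2.
split; [exact: H1|exact: H2].
Qed.

Hypothesis contraction :
  (2 * alpha)^-1 <= (1 - tau) * ((2 * alpha)^-1 + mu / 2).

Local Notation Phi := (potential f mu xs tau alpha).
Local Notation D := (mixed f server theta xs tau).
Local Notation E h := (Ex P h%R).

Let measurable_favg {dT} {T : measurableType dT} (U : T -> 'rV[R]_d) :
  measurable_vector U ->
  measurable_fun setT (fun w => fb (U w) - fb xs).
Proof.
move=> mU; apply: measurable_funB; last exact: measurable_cst.
by apply: (continuous_measurable mU); exact: favg_continuous.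
Qed.

Let measurable_phi (U : Omega -> 'rV[R]_d) : measurable_vector U ->
  measurable_vector (fun w => gphi (grad fb) (grad f1) (U w)).
Proof.
move=> mU; apply: measurable_vectorB.
  by apply: (continuous_measurable_vector mU); exact: grad_continuous.
by apply: (continuous_measurable_vector mU); exact: grad_favg_continuous.
Qed.

Let measurable_mixed (U V : Omega -> 'rV[R]_d) : measurable_vector U ->
  measurable_vector V -> measurable_fun setT (fun w => D (U w) (V w)).
Proof.
move=> mU mV.
have mf1 W : measurable_vector W -> measurable_fun [set: Omega] (fun w => f1 (W w)).
  move=> mW; apply: (continuous_measurable mW); apply: differentiable_cont => x.
  by case: (f_smooth server x).
have mfb W : measurable_vector W -> measurable_fun [set: Omega] (fun w => fb (W w)).
  by move=> mW; apply: (continuous_measurable mW); exact: favg_continuous.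
have mb W : measurable_vector W -> measurable_fun [set: Omega]
    (fun w => bregman fb f1 (grad fb) (grad f1) theta (W w) (V w)).
  move=> mW; apply: measurable_funD; last first.
    apply: measurable_funM; first exact: measurable_cst.
    by apply: measurable_enorm; exact: measurable_vectorB.
  apply: measurable_funB; last first.
    by apply: measurable_dotp; [exact: measurable_phi|exact: measurable_vectorB].
  apply: measurable_funB; apply: measurable_funB; [exact: mf1|exact: mfb|exact: mf1|exact: mfb].
by apply: measurable_funD; apply: measurable_funM; (try exact: measurable_cst);
  apply: mb => //; exact: measurable_vector_cst.
Qed.

Let measurable_potential {dT} {T : measurableType dT} (yz : T -> 'rV[R]_d * 'rV[R]_d) :
  measurable_vector (fun w => (yz w).1) -> measurable_vector (fun w => (yz w).2) ->
  measurable_fun setT (fun w => Phi (yz w)).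
Proof.
move=> my mz; apply: measurable_funD; first exact: measurable_favg.
apply: measurable_funM; first exact: measurable_cst.
by apply: measurable_enorm; apply: measurable_vectorB.
Qed.

Lemma square_integrable_dom (U : Omega -> 'rV[R]_d) (h : Omega -> R) c :
  measurable_vector U -> measurable_fun setT h -> 0 < c ->
  (forall w, c * enorm (U w) ^+ 2 <= h w) -> (E h < +oo)%E ->
  square_integrable P U.
Proof.
move=> mU mh c0 Uh hfin; split=> //.
apply: (@le_lt_trans _ _ (E (fun w => c^-1 * h w))).
  apply: Ex_le; first exact: measurable_enorm.
    by apply: measurable_funM => //; exact: measurable_cst.
  by move=> w; rewrite sqr_ge0 /= ler_pdivlMl.
rewrite ExZ // ?invr_ge0 ?ltW //.
  by rewrite lte_mul_pinfty // lee_fin invr_ge0 ltW.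
by move=> w; apply: le_trans (Uh w); rewrite mulr_ge0 ?sqr_ge0 // ltW.
Qed.

(** A finite expected potential makes the iterates square integrable, which carries over
    to the inner points one step at a time and allows the cancellations. *)
Section OneIteration.
Variable k : nat.
Hypothesis Phi_fin : (E (fun w => Phi (state k w)) < +oo)%E.

Local Notation Y := (fun w => (state k w).1).
Local Notation Z := (fun w => (state k w).2).
Local Notation gap U := (fun w => (fb (U w) - fb xs)%R).

Let known_measurable_vector J (U : Omega -> 'rV[R]_d) :
  known_vector S J U -> measurable_vector U.
Proof. exact: (known_vector_measurable S_measurable). Qed.

Let mY : measurable_vector Y.
Proof. exact: known_measurable_vector (known_state k).1. Qed.

Let mZ : measurable_vector Z.
Proof. exact: known_measurable_vector (known_state k).2. Qed.

Let minner j : measurable_vector (inner k j).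
Proof. exact: known_measurable_vector (@known_inner k j (known_state k)). Qed.

Let gap_ge0 x : 0 <= fb x - fb xs. Proof. by rewrite subr_ge0. Qed.

Let weight_gt0 : 0 < tau * ((2 * alpha)^-1 + mu / 2).
Proof.
have [t0 _] := andP tau01.
by rewrite mulr_gt0 // addr_gt0 // ?divr_gt0 // invr_gt0 mulr_gt0.
Qed.

Let gap_fin : (E (gap Y) < +oo)%E.
Proof.
apply: le_lt_trans Phi_fin; apply: Ex_le; first exact: measurable_favg.
  exact: measurable_potential.
by move=> w; rewrite gap_ge0 /= lerDl mulr_ge0 ?sqr_ge0 // ltW.
Qed.

Let sY : square_integrable P Y.
Proof.
have : square_integrable P (fun w => (state k w).1 - xs).
  apply: (@square_integrable_dom _ (gap Y) (mu / 2)) => //.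
  - by apply: measurable_vectorB => //; exact: measurable_vector_cst.
  - exact: measurable_favg.
  - exact: divr_gt0.
  - by move=> w; exact: favg_growth.
move=> /square_integrableD /(_ (square_integrable_cst P xs)).
by under eq_fun do rewrite subrK.
Qed.

Let sZ : square_integrable P Z.
Proof.
have : square_integrable P (fun w => (state k w).2 - xs).
  apply: (@square_integrable_dom _ (fun w => Phi (state k w))
    (tau * ((2 * alpha)^-1 + mu / 2))) => //.
  - by apply: measurable_vectorB => //; exact: measurable_vector_cst.
  - exact: measurable_potential.
  - by move=> w; rewrite /potential lerDr gap_ge0.
move=> /square_integrableD /(_ (square_integrable_cst P xs)).
by under eq_fun do rewrite subrK.
Qed.

Let sanchor : square_integrable P (anchor k).
Proof. by apply: square_integrableD; exact: square_integrableZ. Qed.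

Let descent j := (gap (inner k j) \+ (fun w => tau * mu / 2 * enorm (xs - inner k j w) ^+ 2))%R.

Let descent_ge0 j w : 0 <= descent j w.
Proof.
have [t0 _] := andP tau01'.
by rewrite addr_ge0 // mulr_ge0 ?sqr_ge0 // divr_ge0 // mulr_ge0 // ltW.
Qed.

Let mdescent j : measurable_fun setT (descent j).
Proof.
apply: measurable_funD; first exact: measurable_favg.
apply: measurable_funM; first exact: measurable_cst.
by apply: measurable_enorm; apply: measurable_vectorB => //; exact: measurable_vector_cst.
Qed.

Let mD j : measurable_fun setT (fun w => D (state k w).1 (inner k j w)).
Proof. exact: measurable_mixed. Qed.

Let D_ge0 j w : 0 <= D (state k w).1 (inner k j w).
Proof. exact: (mixed_ge0 server f_smooth f_related delta_gt0 theta_gt0 delta_theta). Qed.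

Let mixed_fin j : square_integrable P (inner k j) ->
  (E (fun w => D (state k w).1 (inner k j w)) < +oo)%E.
Proof.
move=> su.
have [m1 f1'] := square_integrableB (square_integrable_cst P xs) su.
have [m2 f2'] := square_integrableB sY su.
have e1 := measurable_enorm m1; have e2 := measurable_enorm m2.
apply: (@le_lt_trans _ _ (E (fun w => theta^-1 * (enorm (xs - inner k j w) ^+ 2
   + enorm ((state k w).1 - inner k j w) ^+ 2)))).
  apply: Ex_le => //.
    apply: measurable_funM; first exact: measurable_cst.
    exact: measurable_funD.
  move=> w; rewrite D_ge0 /=.
  exact: (mixed_le server f_smooth f_related delta_gt0 theta_gt0 delta_theta).
rewrite ExZ ?invr_ge0 ?ltW //; last 2 first.
- exact: measurable_funD.
- by move=> w; rewrite addr_ge0 ?sqr_ge0.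
rewrite ExD // => [|w|w]; rewrite ?sqr_ge0 //.
by rewrite lte_mul_pinfty // ?lee_fin ?invr_ge0 ?(ltW theta_gt0) // lte_add_pinfty.
Qed.

Let err j w := \sum_(m <- index_enum 'I_M) M%:R^-1 *:
  (Q (xi k j m w) (drift f server m (anchor k w) (inner k j w))
   - drift f server m (anchor k w) (inner k j w)).

(** The nodes use independent seeds, so the M variances, each carrying a factor
    1 / M^2, add up to a multiple of omega / M. *)
Let noise_bound j : square_integrable P (inner k j) ->
  (E (fun w => enorm (err j w + (2 * theta)^-1 *:
      (mixed_point xs (state k w).1 tau - inner k j w)) ^+ 2) <=
   ((4 * theta ^+ 2)^-1)%:E * E (fun w => enorm (mixed_point xs (state k w).1 tau - inner k j w) ^+ 2)
   + (p / (16 * theta ^+ 2))%:E * E (fun w => enorm (inner k j w - anchor k w) ^+ 2))%E.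
Proof.
move=> su; have ka := known_vector_sub (@past_sub k j) (known_anchor (known_state k)).
have ku := @known_inner k j (known_state k).
have ky := known_vector_sub (@past_sub k j) (known_state k).1.
have kd m : known_vector S (past_inner k j)
    (fun w => drift f server m (anchor k w) (inner k j w)) by exact: known_drift.
have kv : known_vector S (past_inner k j)
    (fun w => mixed_point xs (state k w).1 tau - inner k j w).
  apply: measurable_vectorB => //; apply: measurable_vectorD.
    exact: measurable_vector_cst.
  exact: measurable_vectorZ.
have kW : known_vector S (past_inner k j)
    (fun w => (2 * theta)^-1 *: (mixed_point xs (state k w).1 tau - inner k j w)).
  exact: measurable_vectorZ.
pose src m : I := inr (k, j, m).
have isrc : injective src by move=> m m' [].
have fresh m : m \in index_enum 'I_M -> ~ past_inner k j (src m).
  by move=> _ /=; rewrite !ltnn andbF.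
have := @expected_sqr_sum_sources _ _ _ P _ S S_measurable S_setT S_setI indep _ _ _ nu Q omega
  omega_ge0 cQ 'I_M src (fun m => xi k j m) (index_enum 'I_M) M%:R^-1
  (fun m w => drift f server m (anchor k w) (inner k j w)) (past_inner k j) _ isrc
  (fun m => mxi k j m) (fun m => @subset_refl _ _) (fun m B => @lawxi k j m B)
  (index_enum_uniq _) fresh kd kW.
move=> h; apply: le_trans h _; apply: leeD.
  have -> : (fun w => (enorm ((2 * theta)^-1 *: (mixed_point xs (state k w).1 tau - inner k j w)) ^+ 2)%:E)
    = (fun w => ((4 * theta ^+ 2)^-1 * enorm (mixed_point xs (state k w).1 tau - inner k j w) ^+ 2)%:E).
    rewrite funeqE => w; rewrite enormZ exprMn real_normK ?num_real //; congr (_ * _)%:E.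
    by rewrite exprVn exprMn; congr (_ * _)^-1; ring.
  rewrite -/(E (fun w => (4 * theta ^+ 2)^-1 * _)) ExZ //.
  - exact: measurable_enorm (known_measurable_vector kv).
  - by rewrite invr_ge0 mulr_ge0 ?sqr_ge0.
  - by move=> w; exact: sqr_ge0.
have [mr fr] := square_integrableB su sanchor.
have mr2 := measurable_enorm mr.
have Er0 : (0 <= E (fun w => enorm (inner k j w - anchor k w) ^+ 2))%E.
  by apply: Ex_ge0 => w; exact: sqr_ge0.
have dm m : (\int[P]_w (enorm (drift f server m (anchor k w) (inner k j w)) ^+ 2)%:E <=
    (4 * delta ^+ 2)%:E * E (fun w => enorm (inner k j w - anchor k w) ^+ 2))%E.
  rewrite -ExZ //; last 2 first.
  - by rewrite mulr_ge0 ?sqr_ge0.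
  - by move=> w; exact: sqr_ge0.
  apply: Ex_le.
  - exact: measurable_enorm (known_measurable_vector (kd m)).
  - by apply: measurable_funM => //; exact: measurable_cst.
  - by move=> w; rewrite sqr_ge0 /=; exact: drift_sqr_le.
have c0 : 0 <= M%:R^-1 ^+ 2 * omega by rewrite mulr_ge0 ?sqr_ge0.
apply: (@le_trans _ _ (\sum_(m < M) ((M%:R^-1 ^+ 2 * omega)%:E *
    ((4 * delta ^+ 2)%:E * E (fun w => enorm (inner k j w - anchor k w) ^+ 2))))%E).
  by apply: lee_sum => m _; apply: lee_wpmul2l; rewrite ?lee_fin.
move: Er0 fr; case: (Ex P _) => [r| |] // r0 _.
under eq_bigr do rewrite -!EFinM.
rewrite sumEFin -EFinM lee_fin sumr_const card_ord -[leLHS]mulr_natr.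
have M0 : M%:R != 0 :> R by rewrite pnatr_eq0; case: (M) server => [[]|].
have -> : M%:R^-1 ^+ 2 * omega * (4 * delta ^+ 2 * r) * M%:R =
    omega / M%:R * (4 * delta ^+ 2) * r by field.
by apply: ler_wpM2r; rewrite // -lee_fin.
Qed.

Let expected_step j : square_integrable P (inner k j) ->
  (E (descent j.+1) + E (fun w => D (state k w).1 (inner k j.+1 w)) <=
   (1 - tau)%:E * E (gap Y) + E (fun w => D (state k w).1 (inner k j w))
   + (p / (16 * theta))%:E * E (fun w => enorm (inner k j w - anchor k w) ^+ 2))%E.
Proof.
move=> su.
have [t0 t1] := andP tau01'.
have sv : square_integrable P (fun w => mixed_point xs (state k w).1 tau - inner k j w).
  exact: (square_integrableB (square_integrableD (square_integrable_cst P _)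
    (square_integrableZ _ sY)) su).
have [mv fv] := sv; have mv2 := measurable_enorm mv.
have [mr fr] := square_integrableB su sanchor; have mr2 := measurable_enorm mr.
have merr : measurable_vector (err j).
  apply: measurable_vector_sum => m; apply: measurable_vectorZ.
  have md : measurable_vector (fun w => drift f server m (anchor k w) (inner k j w)).
    apply: known_measurable_vector; apply: known_drift.
      exact: known_vector_sub (@past_sub k j) (known_anchor (known_state k)).
    exact: (@known_inner k j (known_state k)).
  apply: measurable_vectorB => //; have [mQ _ _] := cQ.
  by apply: measurable_random_map_comp.
pose noisy w := enorm (err j w + (2 * theta)^-1 *:
      (mixed_point xs (state k w).1 tau - inner k j w)) ^+ 2.
have mnoisy : measurable_fun setT noisy.
  by apply: measurable_enorm; apply: measurable_vectorD => //; exact: measurable_vectorZ.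
have th4 : 0 <= (4 * theta)^-1 by rewrite invr_ge0 mulr_ge0 // ltW.
have mgY := measurable_favg mY.
have step : (E (descent j.+1) + E (fun w => D (state k w).1 (inner k j.+1 w))
    + (4 * theta)^-1%:E * E (fun w => enorm (mixed_point xs (state k w).1 tau - inner k j w) ^+ 2) <=
   (1 - tau)%:E * E (gap Y) + E (fun w => D (state k w).1 (inner k j w))
   + theta%:E * E noisy)%E.
  pose V w := enorm (mixed_point xs (state k w).1 tau - inner k j w) ^+ 2.
  have V0 w : 0 <= V w by exact: sqr_ge0.
  have n0 w : 0 <= noisy w by exact: sqr_ge0.
  have mcV : measurable_fun setT (fun w => (4 * theta)^-1 * V w).
    by apply: measurable_funM => //; exact: measurable_cst.
  have cV0 w : 0 <= (4 * theta)^-1 * V w by exact: mulr_ge0.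
  have mtn : measurable_fun setT (fun w => theta * noisy w).
    by apply: measurable_funM => //; exact: measurable_cst.
  have tn0 w : 0 <= theta * noisy w by rewrite mulr_ge0 // ltW.
  have mgY' : measurable_fun setT (fun w => (1 - tau) * (fb (state k w).1 - fb xs)).
    by apply: measurable_funM => //; exact: measurable_cst.
  have t1' : 0 <= 1 - tau by rewrite subr_ge0.
  have gY0 w : 0 <= (1 - tau) * (fb (state k w).1 - fb xs).
    exact: mulr_ge0 (gap_ge0 _).
  have mdD := measurable_funD (mdescent j.+1) (mD j.+1).
  have dD0 w : 0 <= descent j.+1 w + D (state k w).1 (inner k j.+1 w).
    exact: addr_ge0 (descent_ge0 _ _) (D_ge0 _ _).
  have mgD := measurable_funD mgY' (mD j).
  have gD0 w : 0 <= (1 - tau) * (fb (state k w).1 - fb xs) + D (state k w).1 (inner k j w).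
    exact: addr_ge0 (gY0 w) (D_ge0 _ _).
  rewrite -(ExZ P mv2 th4 V0) -(ExD P (mdescent _) (mD _) (descent_ge0 _) (D_ge0 _)).
  rewrite -(ExD P mdD mcV dD0 cV0) -(ExZ P mnoisy (ltW theta_gt0) n0).
  rewrite -(ExZ P mgY t1' (fun w => gap_ge0 _)) -(ExD P mgY' (mD j) gY0 (D_ge0 j)).
  rewrite -(ExD P mgD mtn gD0 tn0); apply: Ex_le.
  - exact: measurable_funD mdD mcV.
  - exact: measurable_funD mgD mtn.
  - move=> w; rewrite (addr_ge0 (dD0 w) (cV0 w)) /=.
    have := path_step f_smooth f_related f_convex delta_gt0 mu_gt0 theta_gt0 delta_theta
      xs tau01 (state k w).1 (inner_succ k j w).
    by rewrite /descent /noisy /V /err /=; lra.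
have nb := noise_bound su; rewrite -/noisy in nb.
have v0 : (0 <= E (fun w => enorm (mixed_point xs (state k w).1 tau - inner k j w) ^+ 2))%E.
  by apply: Ex_ge0 => w; exact: sqr_ge0.
have r0 : (0 <= E (fun w => enorm (inner k j w - anchor k w) ^+ 2))%E.
  by apply: Ex_ge0 => w; exact: sqr_ge0.
have := gap_fin; have := mixed_fin su.
have g0 : (0 <= E (gap Y))%E by exact: Ex_ge0.
have d0 : (0 <= E (fun w => D (state k w).1 (inner k j w)))%E by exact: Ex_ge0.
move=> dfin gfin.
exact: (cancel_variance theta_gt0 v0 fv r0 fr g0 gfin d0 dfin step nb).
Qed.

Let distance_fin j : square_integrable P (inner k j) ->
  (E (fun w => enorm (inner k j w - anchor k w) ^+ 2) < +oo)%E.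
Proof. by move=> su; have [] := square_integrableB su sanchor. Qed.

Let step_fin j : square_integrable P (inner k j) ->
  (E (descent j.+1) + E (fun w => D (state k w).1 (inner k j.+1 w)) < +oo)%E.
Proof.
move=> su; apply: le_lt_trans (expected_step su) _.
have [t0 t1] := andP tau01'.
have c0 : 0 <= p / (16 * theta) by rewrite divr_ge0 ?mulr_ge0 // ltW.
apply: lte_add_pinfty; last first.
  by apply: lte_mul_pinfty => //; exact: distance_fin.
apply: lte_add_pinfty; last exact: mixed_fin.
by apply: lte_mul_pinfty; [rewrite lee_fin subr_ge0| |exact: gap_fin].
Qed.

Let sinner j : square_integrable P (inner k j).
Proof.
elim: j => [|j ih]; first exact: sanchor.
have [t0 _] := andP tau01.
have c0 : 0 < tau / (4 * theta) by rewrite divr_gt0 // mulr_gt0.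
have mx : measurable_vector (fun w => xs - inner k j.+1 w).
  by apply: measurable_vectorB => //; exact: measurable_vector_cst.
have sx : square_integrable P (fun w => xs - inner k j.+1 w).
  apply: (@square_integrable_dom _ _ _ mx (mD j.+1) c0) => [w|].
    exact: (mixed_ge server f_smooth f_related delta_gt0 theta_gt0 delta_theta).
  apply: le_lt_trans (step_fin ih); rewrite leeDr //; exact: Ex_ge0.
have := square_integrableB (square_integrable_cst P xs) sx.
by under eq_fun do rewrite subKr.
Qed.

Let expected_potential j :
  (E (fun w => Phi (after_epoch k j w))
   + p%:E * E (fun w => D (state k w).1 (anchor k w))
   + (7 / 64 * p / theta)%:E * E (fun w => enorm (inner k j w - anchor k w) ^+ 2) <=
   E (descent j) + p%:E * E (fun w => D (state k w).1 (inner k j w))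
   + (tau / (2 * alpha))%:E * E (fun w => enorm (xs - (state k w).2) ^+ 2))%E.
Proof.
have [t0 _] := andP tau01.
have [k1 k2] := @known_after_epoch k j (known_state k).
have mP : measurable_fun setT (fun w => Phi (after_epoch k j w)).
  by apply: measurable_potential; exact: known_measurable_vector.
have P0 w : 0 <= Phi (after_epoch k j w) by exact: potential_ge0.
have mDa := mD 0%N; have Da0 := D_ge0 0%N.
have [mr _] := square_integrableB (sinner j) sanchor; have mr2 := measurable_enorm mr.
have [mz _] := square_integrableB (square_integrable_cst P xs) sZ.
have mz2 := measurable_enorm mz.
have sq0 (U : Omega -> 'rV[R]_d) w : 0 <= enorm (U w) ^+ 2 by exact: sqr_ge0.
have c1 : 0 <= 7 / 64 * p / theta by rewrite divr_ge0 ?mulr_ge0 // ltW.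
have c2 : 0 <= tau / (2 * alpha) by rewrite divr_ge0 ?mulr_ge0 // ltW.
have mZc c (h : Omega -> R) : measurable_fun setT h -> measurable_fun [set: Omega] (fun w => c * h w).
  by move=> mh; apply: measurable_funM => //; exact: measurable_cst.
have p0 := ltW p_gt0.
have m1 := mZc p _ mDa; have m2 := mZc (7 / 64 * p / theta) _ mr2.
have m3 := mZc p _ (mD j); have m4 := mZc (tau / (2 * alpha)) _ mz2.
have n1 w := mulr_ge0 p0 (Da0 w); have n2 w := mulr_ge0 c1 (sq0 (fun w => inner k j w - anchor k w) w).
have n3 w := mulr_ge0 p0 (D_ge0 j w); have n4 w := mulr_ge0 c2 (sq0 (fun w => xs - (state k w).2) w).
have l1 := measurable_funD mP m1; have l2 := measurable_funD (mdescent j) m3.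
have q1 w := addr_ge0 (P0 w) (n1 w); have q2 w := addr_ge0 (descent_ge0 j w) (n3 w).
have lhs := ExD P l1 m2 q1 n2; rewrite (ExD P mP m1 P0 n1) in lhs.
rewrite (ExZ P mDa p0 Da0) (ExZ P mr2 c1 (sq0 _)) in lhs.
have rhs := ExD P l2 m4 q2 n4; rewrite (ExD P (mdescent j) m3 (descent_ge0 j) n3) in rhs.
rewrite (ExZ P (mD j) p0 (D_ge0 j)) (ExZ P mz2 c2 (sq0 _)) in rhs.
have tr (A B A' B' : \bar R) : A' = A -> B' = B -> (A' <= B')%E -> (A <= B)%E.
  by move=> -> ->.
apply: tr lhs rhs _.
apply: Ex_le; [exact: measurable_funD l1 m2|exact: measurable_funD l2 m4|move=> w].
rewrite (addr_ge0 (q1 w) (n2 w)) /=.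
have := path_potential f_smooth f_related delta_gt0 mu_gt0 theta_gt0 delta_theta
  xs tau01 p_gt0 alpha_gt0 tau_alpha (erefl (anchor k w)) (erefl (after_epoch k j w)).
rewrite -(enormN (anchor k w - _)) opprB; exact.
Qed.

(** Everything but the epoch length that the outcome of iteration k may use. *)
Let past_epoch : set I := fun i =>
  match i with inl l => (l < k)%N | inr (l, _, _) => (l <= k)%N end.

(** The one-step inequality in expectation, averaged over the geometric epoch
    length, meets the potential inequality at the end of the epoch. *)
Lemma iteration_contracts :
  (E (fun w => Phi (state k.+1 w)) <= (1 - tau)%:E * E (fun w => Phi (state k w)))%E.
Proof.
have [t0 _] := andP tau01; have [_ t1] := andP tau01'; have [_ p1] := andP p01.
pose a j := fine (E (fun w => D (state k w).1 (inner k j w))).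
pose r j := fine (E (fun w => enorm (inner k j w - anchor k w) ^+ 2)).
pose h j := fine (E (descent j)).
pose psi j := fine (E (fun w => Phi (after_epoch k j w))).
pose F := fine (E (gap Y)).
pose z := fine (E (fun w => enorm (xs - (state k w).2) ^+ 2)).
have Efin g : (forall w, 0 <= g w) -> (E g < +oo)%E -> E g = (fine (E g))%:E.
  by move=> g0 gfin; rewrite fineK // ge0_fin_numE // Ex_ge0.
have sq0 (U : Omega -> 'rV[R]_d) w : 0 <= enorm (U w) ^+ 2 by exact: sqr_ge0.
have aE j : E (fun w => D (state k w).1 (inner k j w)) = (a j)%:E.
  exact: Efin (D_ge0 j) (mixed_fin (sinner j)).
have rE j : E (fun w => enorm (inner k j w - anchor k w) ^+ 2) = (r j)%:E.
  exact: Efin (sq0 _) (distance_fin (sinner j)).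
have hE j : E (descent j.+1) = (h j.+1)%:E.
  apply: Efin (descent_ge0 j.+1) _.
  by apply: le_lt_trans (step_fin (sinner j)); rewrite leeDl // Ex_ge0.
have FE : E (gap Y) = F%:E by apply: Efin gap_fin => w; exact: gap_ge0.
have zE : E (fun w => enorm (xs - (state k w).2) ^+ 2) = z%:E.
  apply: Efin (sq0 _) _.
  by have [] := square_integrableB (square_integrable_cst P xs) sZ.
have a0 j : 0 <= a j by rewrite -lee_fin -aE; exact: Ex_ge0.
have r0 j : 0 <= r j by rewrite -lee_fin -rE; exact: Ex_ge0 (sq0 _).
have F0 : 0 <= F by rewrite -lee_fin -FE; apply: Ex_ge0 => w; exact: gap_ge0.
have z0 : 0 <= z by rewrite -lee_fin -zE; exact: Ex_ge0 (sq0 _).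
have r00 : r 0%N = 0.
  rewrite /r (_ : (fun w => _) = fun=> 0); first by rewrite /Ex integral0.
  by rewrite funeqE => w; rewrite subrr enorm0 expr0n.
have P0 j w : 0 <= Phi (after_epoch k j w) by exact: potential_ge0.
have pot j := fin_potential (expected_potential j.+1) (Ex_ge0 P (P0 j.+1))
  (aE 0%N) (rE j.+1) (hE j) (aE j.+1) zE.
have psiE j : E (fun w => Phi (after_epoch k j.+1 w)) = (psi j.+1)%:E by case: (pot j).
have step j := fin_step (expected_step (sinner j)) (hE j) (aE j.+1) FE (aE j) (rE j).
have q01 : 0 <= 1 - p <= 1 by rewrite subr_ge0 p1 /= lerBlDr lerDl ltW.
have Hc0 : 0 <= (1 - tau) * F + tau / (2 * alpha) * z.
  by rewrite addr_ge0 // mulr_ge0 ?subr_ge0 // divr_ge0 ?mulr_ge0 // ltW.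
have kappas : 0 <= p / (16 * theta) <= 7 / 64 * p / theta.
  rewrite divr_ge0 ?mulr_ge0 ?(ltW p_gt0) ?(ltW theta_gt0) //=.
  rewrite (_ : p / (16 * theta) = 4 / 64 * (p / theta)); last by field; rewrite gt_eqF.
  have : 0 <= p / theta by rewrite divr_ge0 ?(ltW p_gt0) ?(ltW theta_gt0).
  rewrite -(mulrA (7 / 64)); move: (p / theta) => c c0; lra.
have pot' j : psi j.+1 + p * a 0%N + 7 / 64 * p / theta * r j.+1 <=
    h j.+1 + p * a j.+1 + tau / (2 * alpha) * z := (pot j).2.
have main := weighted_descent (psi := psi) (esym (subKr 1 p)) q01 Hc0 kappas a0 r0 r00
  step pot'.
have fresh : ~ past_epoch (inl k) by rewrite /= ltnn.
have kPhi n : known_fun S past_epoch (fun w => (Phi (after_epoch k n w))%:E).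
  have sub : past_inner k n `<=` past_epoch.
    move=> [l|[[l i] m]] //= /orP[/ltnW|/andP[/eqP -> _]] //.
  have [k1 k2] := @known_after_epoch k n (known_state k).
  apply/measurable_EFinP; apply: measurable_potential.
    exact: known_vector_sub sub k1.
  exact: known_vector_sub sub k2.
have -> : E (fun w => Phi (state k.+1 w)) = (\int[P]_w (Phi (after_epoch k (N k w) w))%:E)%E.
  by [].
apply: (@le_trans _ _ ((1 - tau) * F + tau / (2 * alpha) * z)%:E).
  apply: (@geometric_expectation_le _ _ _ P _ S S_measurable S_setT S_setI indep (N k) (inl k)
    past_epoch (fun n w => (Phi (after_epoch k n w))%:E) p _ _ _ _ _ _ _ psi _ (p * a 0%N)) => //.
have split_Phi : E (fun w => Phi (state k w)) =
    (F + tau * ((2 * alpha)^-1 + mu / 2) * z)%:E.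
  have [mz _] := square_integrableB (square_integrable_cst P xs) sZ.
  have mz2 := measurable_enorm mz.
  rewrite EFinD EFinM -FE -zE -(ExZ P mz2 (ltW weight_gt0) (sq0 _)).
  have mwz : measurable_fun setT
      (fun w => tau * ((2 * alpha)^-1 + mu / 2) * enorm (xs - (state k w).2) ^+ 2).
    by apply: measurable_funM => //; exact: measurable_cst.
  have wz0 w : 0 <= tau * ((2 * alpha)^-1 + mu / 2) * enorm (xs - (state k w).2) ^+ 2.
    by rewrite mulr_ge0 ?sqr_ge0 // ltW.
  rewrite -(ExD P (measurable_favg mY) mwz (fun w => gap_ge0 _) wz0).
  by apply: eq_integral => w _; rewrite /potential -(enormN (xs - _)) opprB.
rewrite split_Phi -EFinM lee_fin mulrDr lerD2l.
have := ler_wpM2l (mulr_ge0 (ltW t0) z0) contraction.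
rewrite invfM; lra.
Qed.

End OneIteration.

Lemma potential_decay k :
  (E (fun w => Phi (state k w)) <= ((1 - tau) ^+ k * Phi (y0, y0))%:E)%E.
Proof.
have [_ t1] := andP tau01'.
elim: k => [|k ih].
  have -> : E (fun w => Phi (state 0 w)) = (\int[P]_w (Phi (y0, y0))%:E)%E by [].
  by rewrite expr0 mul1r integral_cst //= probability_setT mule1.
have fin : (E (fun w => Phi (state k w)) < +oo)%E by exact: le_lt_trans ih (ltry _).
apply: le_trans (iteration_contracts fin) _.
rewrite exprS -mulrA EFinM; apply: lee_wpmul2l ih.
by rewrite lee_fin subr_ge0.
Qed.

Lemma expected_gap_le k :
  (E (fun w => (fb (state k w).1 - fb xs)%R) <= ((1 - tau) ^+ k * Phi (y0, y0))%:E)%E.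
Proof.
apply: le_trans (potential_decay k); have [t0 _] := andP tau01.
have [ky kz] := known_state k.
have my := known_vector_measurable S_measurable ky.
have mz := known_vector_measurable S_measurable kz.
apply: Ex_le; [exact: measurable_favg|exact: measurable_potential|move=> w].
rewrite subr_ge0 xs_min /= lerDl mulr_ge0 ?sqr_ge0 // mulr_ge0 ?(ltW t0) //.
by rewrite addr_ge0 // ?divr_ge0 ?invr_ge0 ?mulr_ge0 ?(ltW alpha_gt0) ?(ltW mu_gt0).
Qed.

Lemma expected_length k : (E (fun w => (N k w)%:R) <= p^-1%:E)%E.
Proof.
apply: (@geometric_expectation_le _ _ _ P _ S S_measurable S_setT S_setI indep (N k)
  (inl k) set0 (fun n _ => n%:R%:E) p _ _ _ _ _ _ _ (fun n => n%:R) _ 0) => //.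
- by move=> n; exact: measurable_cst.
- move=> n; rewrite (integral_cst P measurableT n.+1%:R%:E) /=.
  by rewrite probability_setT mule1.
- by move=> n; rewrite mul0r addr0; exact: geometric_mean_le.
Qed.

Lemma expected_cost K (c c' : R) : 0 <= c -> 0 <= c' ->
  (E (fun w => comm_cost K (fun i => N i w) c c') <= (K%:R * (2 * c + c' / p))%:E)%E.
Proof.
move=> c0 c'0.
have mNr k : measurable_fun setT (fun w => (N k w)%:R : R).
  by apply: (measurableT_comp _ (mN k)).
have mcost k : measurable_fun setT (fun w => 2 * c + (N k w)%:R * c').
  apply: measurable_funD; first exact: measurable_cst.
  by apply: measurable_funM => //; exact: measurable_cst.
have cost0 k w : 0 <= 2 * c + (N k w)%:R * c' by rewrite addr_ge0 // mulr_ge0.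
have one k : (E (fun w => 2 * c + (N k w)%:R * c')%R <= (2 * c + c' / p)%:E)%E.
  have mc : measurable_fun [set: Omega] (fun _ => 2 * c) by exact: measurable_cst.
  have mNc : measurable_fun setT (fun w => (N k w)%:R * c').
    by apply: measurable_funM => //; exact: measurable_cst.
  have ENc : E (fun w => (N k w)%:R * c') = (c'%:E * E (fun w => (N k w)%:R))%E.
    rewrite -(ExZ P (mNr k) c'0 (fun w => ler0n _ _)); congr (Ex P _).
    by rewrite funeqE => w; rewrite mulrC.
  have c20 : 0 <= 2 * c by rewrite mulr_ge0.
  rewrite (ExD P mc mNc (fun=> c20) (fun w => mulr_ge0 (ler0n _ _) c'0)) EFinD leeD //.
    by rewrite /Ex integral_cst //= probability_setT mule1.
  by rewrite ENc EFinM; apply: lee_wpmul2l; [rewrite lee_fin|exact: expected_length].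
rewrite /comm_cost; elim: K => [|K ih].
  under eq_fun do rewrite big_ord0.
  by rewrite /Ex integral0 mul0r.
under eq_fun do rewrite big_ord_recr /=.
have msum : measurable_fun [set: Omega]
    (fun w => \sum_(i < K) (2 * c + (N i w)%:R * c')).
  exact: measurable_sum.
have sum0 w : 0 <= \sum_(i < K) (2 * c + (N i w)%:R * c') by apply: sumr_ge0.
rewrite (ExD P msum (mcost K) sum0 (cost0 K)).
have -> : K.+1%:R * (2 * c + c' / p) = K%:R * (2 * c + c' / p) + (2 * c + c' / p).
  by rewrite -natr1 [LHS]mulrDl mul1r.
by rewrite EFinD; exact: leeD ih (one K).
Qed.

End StochasticOlga.

(** * Step sizes and rate *)

Section StepSizes.
Context {R : realType}.
Variables (M : nat) (delta mu omega gamma p theta tau alpha : R).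
Hypotheses (M_gt0 : (0 < M)%N) (delta_gt0 : 0 < delta) (mu_gt0 : 0 < mu).
Hypotheses (omega_gt1 : 1 < omega) (omega_gamma : omega <= gamma).
Hypothesis pE : p = gamma^-1.
Hypothesis thetaE : theta = Num.min (Num.sqrt p * Num.sqrt M%:R
  / (8 * delta * Num.sqrt omega)) (2 * delta)^-1.
Hypothesis tauE : tau = Num.min (Num.sqrt mu * (theta `^ 2^-1) * (p `^ (- 2^-1)) / 4) 4^-1.
Hypothesis alphaE : alpha = theta * p^-1 / (8 * tau).

Let gamma_gt1 : 1 < gamma. Proof. exact: lt_le_trans omega_gamma. Qed.
Let gamma_gt0 : 0 < gamma. Proof. exact: lt_trans gamma_gt1. Qed.
Let omega_gt0 : 0 < omega. Proof. exact: lt_trans omega_gt1. Qed.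
Let Mr_gt0 : 0 < M%:R :> R. Proof. by rewrite ltr0n. Qed.

Lemma p_in01 : 0 < p <= 1.
Proof. by rewrite pE invr_gt0 gamma_gt0 invf_le1 // ltW. Qed.

Let p_gt0 : 0 < p. Proof. by case/andP: p_in01. Qed.

Lemma theta_positive : 0 < theta.
Proof.
rewrite thetaE lt_min; apply/andP; split; last by rewrite invr_gt0 mulr_gt0.
by apply: divr_gt0; rewrite !mulr_gt0 ?sqrtr_gt0.
Qed.

Lemma delta_le_theta : delta <= (2 * theta)^-1.
Proof.
have h : theta <= (2 * delta)^-1 by rewrite thetaE ge_min lexx orbT.
rewrite -[leLHS]invrK lef_pV2 ?posrE ?invr_gt0 ?mulr_gt0 ?theta_positive //.
have -> : delta^-1 = 2 * (2 * delta)^-1 by field; rewrite gt_eqF.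
by rewrite ler_pM2l.
Qed.

(** The first bound in the definition of theta, squared. *)
Lemma theta_noise : omega / M%:R * (4 * delta ^+ 2) <= p / (16 * theta ^+ 2).
Proof.
have th := theta_positive.
have h : theta <= Num.sqrt p * Num.sqrt M%:R / (8 * delta * Num.sqrt omega).
  by rewrite thetaE ge_min lexx.
have : theta ^+ 2 <= p * M%:R / (64 * delta ^+ 2 * omega).
  have h0 : 0 <= Num.sqrt p * Num.sqrt M%:R / (8 * delta * Num.sqrt omega).
    exact: le_trans (ltW th) h.
  apply: le_trans (lerXn2r 2 (ltW th) h0 h) _.
  rewrite exprMn exprVn !exprMn (sqr_sqrtr (ltW p_gt0)) (sqr_sqrtr (ltW Mr_gt0)).
  rewrite (sqr_sqrtr (ltW omega_gt0)).
  rewrite le_eqVlt; apply/orP; left; apply/eqP.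
  by field; rewrite !gt_eqF.
rewrite ler_pdivlMr ?mulr_gt0 ?exprn_gt0 // => h2.
rewrite ler_pdivlMr ?mulr_gt0 ?exprn_gt0 //.
have -> : omega / M%:R * (4 * delta ^+ 2) * (16 * theta ^+ 2) =
  theta ^+ 2 * (64 * delta ^+ 2 * omega) / M%:R by ring.
by rewrite ler_pdivrMr.
Qed.

Let tau1 := Num.sqrt mu * (theta `^ 2^-1) * (p `^ (- 2^-1)) / 4.

Let tau1_gt0 : 0 < tau1.
Proof.
by rewrite divr_gt0 // !mulr_gt0 ?sqrtr_gt0 ?powR_gt0 // theta_positive.
Qed.

Let tau1_sqr : tau1 ^+ 2 = mu * theta * gamma / 16.
Proof.
have th := theta_positive.
rewrite /tau1 powRN powR12_sqrt ?(ltW th) // powR12_sqrt ?(ltW p_gt0) //.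
rewrite !exprMn !exprVn (sqr_sqrtr (ltW mu_gt0)) (sqr_sqrtr (ltW th)).
rewrite (sqr_sqrtr (ltW p_gt0)) pE invrK.
by field.
Qed.

Lemma tau_in01 : 0 < tau <= 4^-1.
Proof. by rewrite tauE lt_min tau1_gt0 invr_gt0 /= ge_min lexx orbT andbT. Qed.

Let tau_le1 : tau <= tau1. Proof. by rewrite tauE ge_min lexx. Qed.

Lemma alpha_positive : 0 < alpha.
Proof.
have [t0 _] := andP tau_in01.
by rewrite alphaE divr_gt0 ?mulr_gt0 ?invr_gt0 // theta_positive.
Qed.

Lemma tau_alphaE : tau * alpha = theta / (8 * p).
Proof.
have [t0 _] := andP tau_in01.
by rewrite alphaE; field; rewrite !gt_eqF.
Qed.

(** In fact alpha mu = 2 tau1^2 / tau, with tau <= tau1. *)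
Let alpha_mu : 2 * tau <= alpha * mu.
Proof.
have [t0 _] := andP tau_in01.
have -> : alpha * mu = 2 * tau1 ^+ 2 / tau.
  by rewrite tau1_sqr alphaE pE invrK; field; rewrite gt_eqF.
rewrite ler_pdivlMr // -mulrA ler_pM2l // -expr2.
exact: (lerXn2r 2 (ltW t0) (ltW tau1_gt0) tau_le1).
Qed.

Lemma alpha_inv_le : tau / (2 * alpha) <= mu / 4.
Proof.
have a0 := alpha_positive.
rewrite ler_pdivrMr ?mulr_gt0 //; have := alpha_mu; lra.
Qed.

Lemma alpha_contraction : (2 * alpha)^-1 <= (1 - tau) * ((2 * alpha)^-1 + mu / 2).
Proof.
have [t0 t1] := andP tau_in01; have := alpha_inv_le.
have : tau * mu <= 4^-1 * mu by rewrite ler_pM2r.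
move: ((2 * alpha)^-1) => a; have := mu_gt0; lra.
Qed.

Definition rate := 1 + Num.sqrt (delta / mu) * ((M%:R `^ (- 4^-1)) + gamma `^ (- 2^-1)).

Lemma rate_ge1 : 1 <= rate.
Proof. by rewrite lerDl mulr_ge0 ?sqrtr_ge0 // addr_ge0 ?powR_ge0. Qed.

(** If tau = 1/4 the 1 of the rate suffices. Otherwise 1 / tau^2 is
    16 / (mu theta gamma), and each of the two bounds that define theta makes it
    at most a multiple of delta / mu times the square of one summand. *)
Lemma inv_tau_le : tau^-1 <= 12 * rate.
Proof.
have [t0 t1] := andP tau_in01; have r1 := rate_ge1.
have r12 : 0 < 12 * rate by rewrite mulr_gt0 // (lt_le_trans ltr01).
rewrite -[leRHS]invrK lef_pV2 ?posrE ?invr_gt0 // tauE le_min -/tau1.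
apply/andP; split; last first.
  by rewrite lef_pV2 ?posrE //; lra.
have th := theta_positive.
rewrite -[leLHS]mul1r ler_pdivrMr // mulrC.
have x0 : 0 <= 12 * rate * tau1 by rewrite mulr_ge0 // ltW.
rewrite -(expr_ge1 (ltn0Sn 1) x0) exprMn tau1_sqr.
have summand t q : 0 <= t -> t ^+ 2 = q -> Num.sqrt (delta / mu) * t <= rate ->
    1 <= 9 * delta * q * theta * gamma -> 1 <= (12 * rate) ^+ 2 * (mu * theta * gamma / 16).
  move=> t0' tq tr h; apply: le_trans h _.
  have s2 : Num.sqrt (delta / mu) ^+ 2 = delta / mu.
    by rewrite sqr_sqrtr // ltW // divr_gt0.
  have -> : 9 * delta * q * theta * gamma =
      (Num.sqrt (delta / mu) * t) ^+ 2 * (9 * mu * theta * gamma).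
    by rewrite exprMn s2 tq; field; rewrite gt_eqF.
  have -> : (12 * rate) ^+ 2 * (mu * theta * gamma / 16) =
      rate ^+ 2 * (9 * mu * theta * gamma) by field.
  apply: ler_wpM2r; first by rewrite !mulr_ge0 // ltW.
  exact: (lerXn2r 2 (mulr_ge0 (sqrtr_ge0 _) t0') (le_trans ler01 r1) tr).
have sq0 := sqrtr_ge0 (delta / mu).
have m0 := powR_ge0 M%:R (- 4^-1 : R); have g0' := powR_ge0 gamma (- 2^-1).
have [hmin|hmin] := leP (Num.sqrt p * Num.sqrt M%:R / (8 * delta * Num.sqrt omega)) (2 * delta)^-1.
- apply: (summand (M%:R `^ (- 4^-1)) (Num.sqrt M%:R)^-1) => //.
  + rewrite -powR12_sqrt ?(ltW Mr_gt0) // -powRN -powR_mulrn // -powRrM.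
    by congr (_ `^ _); field.
  + by rewrite /rate mulrDr; have := mulr_ge0 sq0 g0'; lra.
  + have -> : theta = Num.sqrt p * Num.sqrt M%:R / (8 * delta * Num.sqrt omega).
      by rewrite thetaE; apply/min_idPl.
    have sM : 0 < Num.sqrt (M%:R : R) by rewrite sqrtr_gt0.
    have so : 0 < Num.sqrt omega by rewrite sqrtr_gt0.
    have sg : 0 < Num.sqrt gamma by rewrite sqrtr_gt0.
    have -> : 9 * delta / Num.sqrt M%:R * (Num.sqrt p * Num.sqrt M%:R /
        (8 * delta * Num.sqrt omega)) * gamma = 9 / 8 * (Num.sqrt gamma / Num.sqrt omega).
      rewrite pE sqrtrV ?ltW // -{2}(sqr_sqrtr (ltW gamma_gt0)).
      by field; rewrite !gt_eqF.
    have : 1 <= Num.sqrt gamma / Num.sqrt omega.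
      by rewrite ler_pdivlMr // mul1r ler_wsqrtr.
    lra.
- apply: (summand (gamma `^ (- 2^-1)) gamma^-1) => //.
  + by rewrite powRN (powR12_sqrt (ltW gamma_gt0)) exprVn (sqr_sqrtr (ltW gamma_gt0)).
  + by rewrite /rate mulrDr; have := mulr_ge0 sq0 m0; lra.
  + have -> : theta = (2 * delta)^-1 by rewrite thetaE; apply/min_idPr; exact: ltW.
    have -> : 9 * delta / gamma * (2 * delta)^-1 * gamma = 9 / 2 by field; rewrite !gt_eqF.
    lra.
Qed.

End StepSizes.

(** With K > L / tau the factor (1 - tau)^K is at most exp (- L), and the 1 in L
    absorbs the factor 2 because 2 <= e. *)
Lemma iteration_count {R : realType} (tau gap eps : R) : 0 < tau <= 4^-1 -> 0 <= gap ->
  0 < eps -> let L := 1 + logp (gap / eps) in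
  exists K : nat, (1 - tau) ^+ K * (2 * gap) <= eps /\ K%:R <= 2 * L / tau.
Proof.
move=> /andP[t0 t1] gap0 eps0 L.
have L1 : 1 <= L by rewrite lerDl le_max lexx.
have Lt : 0 <= L / tau by rewrite divr_ge0 ?(ltW t0) // (le_trans ler01).
exists (Num.truncn (L / tau)).+1; split; last first.
  have := truncn_le (L / tau); rewrite Lt => h.
  rewrite -natr1 -mulrA mulr_natl mulr2n lerD // ler_pdivlMr // mul1r; lra.
have small : (1 - tau) ^+ (Num.truncn (L / tau)).+1 <= expR (- L).
  apply: (@le_trans _ _ (expR (- tau) ^+ (Num.truncn (L / tau)).+1)).
    apply: lerXn2r; rewrite ?nnegrE ?expR_ge0 //; first by lra.
    exact: expR_ge1Dx.
  rewrite -expRM_natl ler_expR mulrN lerN2 mulrC -ler_pdivrMl // mulrC.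
  exact: ltW (truncnS_gt _).
have [->|gap_neq0] := eqVneq gap 0; first by rewrite !mulr0 ltW.
have gap_gt0 : 0 < gap by rewrite lt_def gap_neq0.
apply: (@le_trans _ _ (expR (- L) * (2 * gap))).
  by apply: ler_wpM2r small; rewrite mulr_ge0.
have big : 2 * (gap / eps) <= expR L.
  rewrite /L expRD.
  apply: (ler_pM (ler0n _ 2) (ltW (divr_gt0 gap_gt0 eps0))); first exact: expR_ge1Dx.
  rewrite -[leLHS]lnK ?posrE ?divr_gt0 // ler_expR /logp le_max lexx orbT //.
rewrite expRN [leLHS]mulrC (ler_pdivrMr _ _ (expR_gt0 L)) [leRHS]mulrC.
by move: big; rewrite mulrA ler_pdivrMr.
Qed.
(** * Communication complexity *)

(** Quadratic growth bounds the square distance to xs by 2 / mu times the gap, and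
    its weight in the potential is at most mu / 4 + mu / 8. *)
Lemma potential_start {R : realType} {d M : nat} (f : 'I_M -> 'rV[R]_d -> R)
    (mu tau alpha : R) (xs y0 : 'rV[R]_d) :
  (forall m, twice_differentiable (f m)) -> strongly_convex mu (favg f) -> 0 < mu ->
  (forall x, favg f xs <= favg f x) -> tau <= 4^-1 -> tau / (2 * alpha) <= mu / 4 ->
  potential f mu xs tau alpha (y0, y0) <= 2 * (favg f y0 - favg f xs).
Proof.
move=> f_smooth f_convex mu0 xs_min t1 ta.
have := favg_growth f_smooth f_convex xs_min y0.
rewrite /potential /= mulrDr.
set e := enorm _ ^+ 2; have e0 : 0 <= e by rewrite sqr_ge0.
have h1 : tau * (2 * alpha)^-1 * e <= mu / 4 * e by rewrite ler_wpM2r.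
have h2 : tau * (mu / 2) * e <= 4^-1 * (mu / 2) * e.
  by rewrite !ler_wpM2r // divr_ge0 // ltW.
move: h1 h2; rewrite (mulrDl (tau * (2 * alpha)^-1)).
have := mulr_ge0 (ltW mu0) e0.
clearbody e; have := xs_min y0; move: (favg f y0) (favg f xs) => a b.
move: (tau * (2 * alpha)^-1 * e) (tau * (mu / 2) * e) => q r; lra.
Qed.

Lemma powR_half_split {R : realType} (g : R) : 0 < g -> g * g `^ (- 2^-1) = g `^ 2^-1.
Proof.
move=> g0; rewrite -{1}(powRr1 (ltW g0)) -powRD; last by rewrite (gt_eqF g0) implybT.
by congr (_ `^ _); field.
Qed.

Lemma powR_quarter_split {R : realType} (m : R) : 0 < m -> m * m `^ (- 4^-1) = m `^ (3 / 4).
Proof.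
move=> g0; rewrite -{1}(powRr1 (ltW g0)) -powRD; last by rewrite (gt_eqF g0) implybT.
by congr (_ `^ _); field.
Qed.

Lemma total_cost_le {R : realType} (K : nat) (L tau rate q a : R) :
  0 <= L -> K%:R <= 2 * L / tau -> tau^-1 <= 12 * rate -> 0 <= a -> q <= 3 * a ->
  K%:R * q <= 72 * (a * rate) * L.
Proof.
move=> L0 KL tr a0 qa.
apply: (le_trans (ler_wpM2l (ler0n _ _) qa)).
have KL' : K%:R <= 2 * L * (12 * rate).
  apply: (le_trans KL); apply: ler_wpM2l tr; exact: mulr_ge0.
have -> : 72 * (a * rate) * L = 2 * L * (12 * rate) * (3 * a) by ring.
by apply: ler_wpM2r KL'; exact: mulr_ge0.
Qed.

Theorem corollary1 (R : realType) :
  exists C : R, 0 < C /\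
  forall (d M : nat) (d_gt0 : (0 < d)%N) (M_gt0 : (0 < M)%N)
    (f : 'I_M -> 'rV[R]_d -> R) (delta mu : R) (xs : 'rV[R]_d)
    (dX : measure_display) (X : measurableType dX) (nu : probability X R)
    (Q : X -> 'rV[R]_d -> 'rV[R]_d) (omega gamma : R)
    (b : nat) (bits : 'rV[R]_d -> nat)
    (dO : measure_display) (Omega : measurableType dO)
    (P : probability Omega R) (N : nat -> Omega -> nat)
    (xi : nat -> nat -> 'I_M -> Omega -> X) (y0 : 'rV[R]_d),
  (forall m, twice_differentiable (f m)) ->
  0 < delta -> delta_related f delta ->
  0 < mu -> strongly_convex mu (favg f) ->
  (forall x, favg f xs <= favg f x) ->
  1 < omega -> unbiased_compressor nu Q omega ->
  (0 < b)%N -> compression_power nu Q b bits gamma -> omega <= gamma ->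
  let p := gamma^-1 in
  let theta := Num.min (Num.sqrt p * Num.sqrt M%:R
                          / (8 * delta * Num.sqrt omega))
                       (2 * delta)^-1 in
  let tau := Num.min (Num.sqrt mu * (theta `^ 2^-1) * (p `^ (- 2^-1)) / 4)
                     4^-1 in
  let alpha := theta * p^-1 / (8 * tau) in
  olga_randomness P nu p N xi ->
  let y k w := olga_y f (Ordinal M_gt0) Q mu p theta tau alpha y0
                 (fun i => N i w) (fun i j m => xi i j m w) k in
  let A1 := gamma + Num.sqrt (delta / mu)
              * (gamma * (M%:R `^ (- 4^-1)) + gamma `^ 2^-1) in
  let A2 := M%:R * gamma + Num.sqrt (delta / mu)
              * (gamma * (M%:R `^ (3 / 4)) + M%:R * (gamma `^ 2^-1)) in
  let A3 := 1 + Num.sqrt (delta / mu)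
              * ((M%:R `^ (- 4^-1)) + gamma `^ (- 2^-1)) in
  forall eps : R, 0 < eps ->
  let L := 1 + logp ((favg f y0 - favg f xs) / eps) in
  exists K : nat,
    [/\ ('E_P[fun w => (favg f (y K w) - favg f xs)%R] <= eps%:E)%E,
        ('E_P[fun w => CC1 K (fun i => N i w)] <= (C * A1 * L)%R%:E)%E,
        ('E_P[fun w => CC2 K (fun i => N i w) M] <= (C * A2 * L)%R%:E)%E
      & ('E_P[fun w => CC3 K (fun i => N i w) gamma] <= (C * A3 * L)%R%:E)%E].
Proof.
(* 72 = 2 * 12 * 3: at most 2 L / tau iterations, 1 / tau <= 12 A3, and the two
   uncompressed rounds of an iteration cost at most twice the average of its
   compressed ones. *)
exists 72; split; first by rewrite ltr0n.
move=> d M d_gt0 M_gt0 f delta mu xs dX X nu Q omega gamma b bits dO Omega P N xi y0.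
move=> f_smooth delta_gt0 f_related mu_gt0 f_convex xs_min omega_gt1 cQ _ _ omega_gamma.
move=> p theta tau alpha randomness y A1 A2 A3 eps eps_gt0 L.
have pE : p = gamma^-1 by [].
have thetaE : theta = Num.min (Num.sqrt p * Num.sqrt M%:R
  / (8 * delta * Num.sqrt omega)) (2 * delta)^-1 by [].
have tauE : tau = Num.min (Num.sqrt mu * (theta `^ 2^-1) * (p `^ (- 2^-1)) / 4) 4^-1 by [].
have alphaE : alpha = theta * p^-1 / (8 * tau) by [].
have gamma_gt1 : 1 < gamma := lt_le_trans omega_gt1 omega_gamma.
have gamma_gt0 : 0 < gamma := lt_trans ltr01 gamma_gt1.
have Mr_gt0 : 0 < M%:R :> R by rewrite ltr0n.
clearbody alpha; clearbody tau; clearbody theta; clearbody p.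
have p01 := p_in01 omega_gt1 omega_gamma pE.
have theta_gt0 := theta_positive M_gt0 delta_gt0 omega_gt1 omega_gamma pE thetaE.
have delta_theta := delta_le_theta M_gt0 delta_gt0 omega_gt1 omega_gamma pE thetaE.
have noise_small := theta_noise M_gt0 delta_gt0 omega_gt1 omega_gamma pE thetaE.
have tau_in := tau_in01 M_gt0 delta_gt0 mu_gt0 omega_gt1 omega_gamma pE thetaE tauE.
have alpha_gt0 := alpha_positive M_gt0 delta_gt0 mu_gt0 omega_gt1 omega_gamma pE thetaE tauE alphaE.
have tau_alpha := tau_alphaE M_gt0 delta_gt0 mu_gt0 omega_gt1 omega_gamma pE thetaE tauE alphaE.
have alpha_le := alpha_inv_le M_gt0 delta_gt0 mu_gt0 omega_gt1 omega_gamma pE thetaE tauE alphaE.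
have contraction := alpha_contraction M_gt0 delta_gt0 mu_gt0 omega_gt1 omega_gamma pE thetaE tauE alphaE.
have tau_rate : tau^-1 <= 12 * A3 :=
  inv_tau_le M_gt0 delta_gt0 mu_gt0 omega_gt1 omega_gamma pE thetaE tauE.
have [t0 t1] := andP tau_in.
have tau01 : 0 < tau <= 1 by rewrite t0; lra.
have omega_ge0 : 0 <= omega by apply: ltW; exact: lt_trans omega_gt1.
have gap_ge0 : 0 <= favg f y0 - favg f xs by rewrite subr_ge0.
have [K [decay KL]] := iteration_count tau_in gap_ge0 eps_gt0.
have L_ge0 : 0 <= L by apply: addr_ge0 => //; rewrite le_max lexx.
have A1E : A1 = gamma * A3.
  by rewrite /A1 /A3 -(powR_half_split gamma_gt0); ring.
have A2E : A2 = M%:R * (gamma * A3).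
  by rewrite /A2 /A3 -(powR_half_split gamma_gt0) -(powR_quarter_split Mr_gt0); ring.
clearbody A1 A2 A3.
exists K; split.
- rewrite unlock; apply: (le_trans (expected_gap_le (Ordinal M_gt0) y0 f_smooth f_related f_convex
    delta_gt0 mu_gt0 theta_gt0 delta_theta xs_min tau01 p01 alpha_gt0 tau_alpha
    omega_ge0 cQ noise_small randomness contraction K)).
  rewrite lee_fin; apply: le_trans decay; apply: ler_wpM2l; last first.
    exact: potential_start.
  by apply: exprn_ge0; rewrite subr_ge0; lra.
- rewrite A1E unlock; apply: (le_trans (expected_cost p01 randomness K ler01 ler01)).
  rewrite lee_fin; apply: (total_cost_le L_ge0 KL tau_rate (ltW gamma_gt0)).
  rewrite pE; lra.
- rewrite A2E (mulrA M%:R) unlock.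
  apply: (le_trans (expected_cost p01 randomness K (ltW Mr_gt0) (ltW Mr_gt0))).
  rewrite lee_fin; apply: (total_cost_le L_ge0 KL tau_rate).
    by rewrite mulr_ge0 // ltW.
  rewrite pE invrK; have : M%:R * 1 <= M%:R * gamma by rewrite ler_pM2l // ltW.
  lra.
- rewrite -[A3]mul1r unlock.
  have g0 : 0 <= gamma^-1 by rewrite invr_ge0 ltW.
  apply: (le_trans (expected_cost p01 randomness K ler01 g0)).
  rewrite lee_fin; apply: (total_cost_le L_ge0 KL tau_rate) => //.
  rewrite pE invrK mulVf ?gt_eqF //; lra.
Qed.
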